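(* Let $m,n\in\mathbb{N}$ with $m<n$, let $F$ be a field of characteristic $0$, let $V$ be an $m$-dimensional vector space over $F$, and let $U=F\oplus V$. Let $FR_n$ be the rook monoid algebra acting on $U^{\otimes n}$, and let $Y_{m+1}\in FR_{m+1}\subseteq FR_n$ be the anti-symmetrizer. Then $$\mathrm{Ann}_{FR_n}\bigl(U^{\otimes n}\bigr)=\langle Y_{m+1}\rangle,$$ where $\langle Y_{m+1}\rangle$ is the two-sided ideal of $FR_n$ generated by $Y_{m+1}$.
   Context: Rook monoid. A rook $n$-diagram is a graph on a top row of vertices $1,\dots,n$ and a bottom row of vertices $1^-,\dots,n^-$, each edge joining a top vertex to a bottom vertex, and each vertex lying on at most one edge. Vertices on no edge are called isolated. The set $\mathrm{Rd}_n$ of rook $n$-diagrams is a monoid under concatenation: $D_1\cdot D_2$ is obtained by placing $D_1$ above $D_2$ and identifying the bottom row of $D_1$ with the top row of $D_2$. This monoid is the rook monoid $R_n$ (the monoid of $n\times n$ $0/1$-matrices with at most one $1$ in each row and column), and $FR_n$ is its monoid algebra over $F$. Permutations act on the right, and $\sigma\in\mathfrak{S}_n$ is identified with the diagram with edges $\{j,((j)\sigma)^-\}$, $1\le j\le n$. For $1\le i<n$, $s_i$ is the diagram of the transposition $(i\ i+1)$. For $1\le j\le n$, $p_j$ is the diagram with $j,j^-$ isolated and edges $\{k,k^-\}$ for all $k\ne j$. The $s_i$ and $p_j$ generate $R_n$. For $k\le n$, $R_k$ is regarded as the submonoid of $R_n$ of diagrams containing the edges $\{j,j^-\}$ for all $j>k$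 (so $s_i\mapsto s_i$, $p_j\mapsto p_j$). Action. Fix a basis $v_0$ of $F$ and a basis $v_1,\dots,v_m$ of $V$. The left action of $FR_n$ on $U^{\otimes n}$ is determined by: $s_j$ interchanges the $j$-th and $(j+1)$-th tensor factors, and $p_j(v_{i_1}\otimes\cdots\otimes v_{i_n})=\delta_{i_j,0}\,v_{i_1}\otimes\cdots\otimes v_{i_{j-1}}\otimes v_0\otimes v_{i_{j+1}}\otimes\cdots\otimes v_{i_n}$, where $i_1,\dots,i_n\in\{0,1,\dots,m\}$. $\mathrm{Ann}_{FR_n}(U^{\otimes n})$ is the annihilator, i.e. the kernel of $\varphi:FR_n\to\mathrm{End}_F(U^{\otimes n})$ (whose image lies in $\mathrm{End}_{\mathrm{GL}(V)}(U^{\otimes n})$, where $F$ is the trivial $\mathrm{GL}(V)$-module). Signs. For $0\le r\le k$ let $\mathcal{D}_r=\{d\in\mathfrak{S}_k : (1)d<\cdots<(r)d,\ (r+1)d<\cdots<(k)d\}$. Each $D\in\mathrm{Rd}_k$ can be written uniquely as $D=d_1^{-1}p_1\cdots p_r\sigma d_2$ with $0\le r\le k$, $d_1,d_2\in\mathcal{D}_r$, $\sigma\in\mathfrak{S}_{\{r+1,\dots,k\}}$. Put $\ell(D)=\ell(d_1)+\ell(\sigma)+\ell(d_2)$, where $\ell$ is the Coxeter length on $\mathfrak{S}_k$, and $\mathrm{sgn}(D)=(-1)^{r+\ell(D)}$. Let $\mathrm{Rd}_k[r]$ be the set of rook $k$-diagrams with exactly $r$ isolated vertices in each row. Anti-symmetrizer.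 With $k=m+1$, $$Y_{m+1}=\sum_{\sigma\in\mathfrak{S}_{m+1}}\mathrm{sgn}(\sigma)\sigma+\sum_{D\in\mathrm{Rd}_{m+1}[1]}\mathrm{sgn}(D)D\in FR_{m+1}\subseteq FR_n.$$ *)

(* Defs.v *)
From HB Require Import structures.
From mathcomp Require Import all_boot all_order all_algebra all_fingroup.

Set Implicit Arguments.
Unset Strict Implicit.
Unset Printing Implicit Defensive.

Import GRing.Theory.
Local Open Scope ring_scope.

(* Rook n-diagrams. The vertices 1..n of either row are numbered from 0 by    *)
(* 'I_n, and (i, j) is the edge joining the top vertex i to the bottom        *)
(* vertex j.                                                                  *)

Definition is_rook n (E : {set 'I_n * 'I_n}) : bool :=
  [forall e in E, forall f in E,
     ((e.1 == f.1) || (e.2 == f.2)) ==> (e == f)].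

Record rook n := Rook { edges : {set 'I_n * 'I_n}; edgesP : is_rook edges }.

HB.instance Definition _ n := [isSub for @edges n].
HB.instance Definition _ n := [Finite of rook n by <:].

Lemma is_rookP n (E : {set 'I_n * 'I_n}) :
  reflect (forall i j k l, (i, j) \in E -> (k, l) \in E ->
             i = k \/ j = l -> (i, j) = (k, l)) (is_rook E).
Proof.
apply: (iffP forall_inP) => [H i j k l ijE klE /= eq_ij | H [i j] ijE].
  move/forall_inP: (H _ ijE) => /(_ _ klE) /implyP /= Himp; apply/eqP/Himp.
  by case: eq_ij => ->; rewrite eqxx ?orbT.
apply/forall_inP => -[k l] klE; apply/implyP => /= eq_ij; apply/eqP/H => //.
by case/orP: eq_ij => /eqP; [left | right].
Qed.

Lemma edges_inj n : injective (@edges n).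
Proof. exact: val_inj. Qed.

Section RookMonoid.
Variable n : nat.
Implicit Types (D : rook n) (i j k : 'I_n).

Definition isolated_top D : {set 'I_n} :=
  [set i | [forall j, (i, j) \notin edges D]].
Definition isolated_bot D : {set 'I_n} :=
  [set j | [forall i, (i, j) \notin edges D]].

Definition concat_edges D1 D2 : {set 'I_n * 'I_n} :=
  [set e | [exists j, ((e.1, j) \in edges D1) && ((j, e.2) \in edges D2)]].

Lemma concat_edgesP D1 D2 i k :
  reflect (exists2 j, (i, j) \in edges D1 & (j, k) \in edges D2)
          ((i, k) \in concat_edges D1 D2).
Proof. by rewrite inE; apply: (iffP exists_inP) => -[j]; exists j. Qed.

Lemma concat_subproof D1 D2 : is_rook (concat_edges D1 D2).
Proof.
apply/is_rookP => i j k l /concat_edgesP[a ia aj] /concat_edgesP[b kb bl].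
have /is_rookP R1 := edgesP D1; have /is_rookP R2 := edgesP D2.
case=> [eik | ejl].
  have [_ eab] := R1 _ _ _ _ ia kb (or_introl eik).
  by have [_ ->] := R2 _ _ _ _ aj bl (or_introl eab); rewrite eik.
have [eab _] := R2 _ _ _ _ aj bl (or_intror ejl).
by have [-> _] := R1 _ _ _ _ ia kb (or_intror eab); rewrite ejl.
Qed.

Definition rook_mul D1 D2 : rook n := Rook (concat_subproof D1 D2).

Lemma rook_perm_subproof (s : 'S_n) : is_rook [set e | e.2 == s e.1].
Proof.
apply/is_rookP => i j k l; rewrite !inE /= => /eqP-> /eqP->.
by case=> [->|/perm_inj->].
Qed.

(* Products of permutations are those of perm.v, (s * t) j = t (s j), which   *)
(* are the products of permutations acting on the right.                      *)
Definition rook_perm (s : 'S_n) : rook n := Rook (rook_perm_subproof s).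

Lemma rook_p_subproof j : is_rook [set e | (e.1 == e.2) && (e.1 != j)].
Proof.
apply/is_rookP => i i' k l; rewrite !inE /=.
by move=> /andP[/eqP-> _] /andP[/eqP-> _] [] ->.
Qed.

Definition rook_p j : rook n := Rook (rook_p_subproof j).

Lemma rook_mulA : associative rook_mul.
Proof.
move=> D1 D2 D3; apply/edges_inj/setP => -[i l]; apply/concat_edgesP/concat_edgesP.
  move=> [j ij /concat_edgesP[k jk kl]]; exists k => //.
  by apply/concat_edgesP; exists j.
move=> [k /concat_edgesP[j ij jk] kl]; exists j => //.
by apply/concat_edgesP; exists k.
Qed.

Lemma rook_mul1D : left_id (rook_perm 1%g) rook_mul.
Proof.
move=> D; apply/edges_inj/setP => -[i j]; apply/concat_edgesP/idP.
  by move=> [k]; rewrite inE perm1 => /eqP /= ->.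
by move=> ij; exists i => //; rewrite inE perm1.
Qed.

Lemma rook_mulD1 : right_id (rook_perm 1%g) rook_mul.
Proof.
move=> D; apply/edges_inj/setP => -[i j]; apply/concat_edgesP/idP.
  by move=> [k ik]; rewrite inE perm1 => /eqP /= ->.
by move=> ij; exists j => //; rewrite inE perm1.
Qed.

HB.instance Definition _ :=
  isMonoid.Build (rook n) rook_mulA rook_mul1D rook_mulD1.

End RookMonoid.

Lemma rook_permM n (s t : 'S_n) :
  rook_perm (s * t)%g = (rook_perm s * rook_perm t)%g.
Proof.
apply/edges_inj/setP => -[i k]; rewrite inE permM /=.
apply/eqP/concat_edgesP => [-> | [j]].
  by exists (s i); rewrite inE.
by rewrite !inE => /eqP /= -> /eqP.
Qed.

(* R_k is the submonoid of R_n of the diagrams with edges (j, j) for j >= k *)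

Lemma rook_widen_subproof k n (le_kn : (k <= n)%N) (D : rook k) :
  is_rook ([set (widen_ord le_kn e.1, widen_ord le_kn e.2) | e in edges D]
           :|: [set (j, j) | j : 'I_n & (k <= j)%N]).
Proof.
have /is_rookP RD := edgesP D.
have inj_w : injective (widen_ord le_kn) by move=> i j /(congr1 val) eij; apply: val_inj.
have abs (i : 'I_k) (j : 'I_n) : (k <= j)%N -> widen_ord le_kn i <> j.
  by move=> le_kj /(congr1 val) /= ij; rewrite leqNgt -ij ltn_ord in le_kj.
apply/is_rookP => a b c d /setUP[/imsetP[[i j] ijD [-> ->]]|/imsetP[x + [-> ->]]]
  /setUP[/imsetP[[i' j'] ijD' [-> ->]]|/imsetP[y + [-> ->]]]; rewrite ?inE /=.
- move=> eq_ij; have [-> -> //] : (i, j) = (i', j').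
  by apply: RD => //; case: eq_ij => /inj_w; [left|right].
- by move=> le_ky [] /abs.
- by move=> le_kx [] /esym /abs.
- by move=> _ _ [] ->.
Qed.

Definition rook_widen k n (le_kn : (k <= n)%N) (D : rook k) : rook n :=
  Rook (rook_widen_subproof le_kn D).

(* FR_n is a type of its own because {ffun rook n -> F} already carries the   *)
(* pointwise product, whereas the product of FR_n is convolution.             *)

Definition rook_alg (F : fieldType) n : Type := {ffun rook n -> F^o}.

HB.instance Definition _ (F : fieldType) n := GRing.Lmodule.on (rook_alg F n).

Section RookAlgebra.
Variables (F : fieldType) (n : nat).
Implicit Types (D : rook n) (a b c : rook_alg F n).

Definition diag D : rook_alg F n := [ffun E => (E == D)%:R].

Definition rook_alg_mul a b : rook_alg F n :=
  \sum_D \sum_E (a D * b E) *: diag (D * E)%g.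

Lemma rook_alg_sum a : a = \sum_D a D *: diag D.
Proof.
apply/ffunP => D; rewrite sum_ffunE (bigD1 D) //= big1 => [|E neqED].
  by rewrite addr0 !ffunE eqxx /GRing.scale /= mulr1.
by rewrite !ffunE eq_sym (negPf neqED) scaler0.
Qed.

Lemma rook_alg_mulDl : left_distributive rook_alg_mul +%R.
Proof.
move=> a b c; rewrite /rook_alg_mul -big_split; apply: eq_bigr => D _ /=.
by rewrite -big_split; apply: eq_bigr => E _ /=; rewrite ffunE mulrDl scalerDl.
Qed.

Lemma rook_alg_mulDr : right_distributive rook_alg_mul +%R.
Proof.
move=> a b c; rewrite /rook_alg_mul -big_split; apply: eq_bigr => D _ /=.
by rewrite -big_split; apply: eq_bigr => E _ /=; rewrite ffunE mulrDr scalerDl.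
Qed.

Lemma rook_alg_scaleAl (k : F) a b :
  k *: rook_alg_mul a b = rook_alg_mul (k *: a) b.
Proof.
rewrite /rook_alg_mul scaler_sumr; apply: eq_bigr => D _.
rewrite scaler_sumr; apply: eq_bigr => E _.
by rewrite scalerA ffunE mulrA.
Qed.

Lemma rook_alg_scaleAr (k : F) a b :
  k *: rook_alg_mul a b = rook_alg_mul a (k *: b).
Proof.
rewrite /rook_alg_mul scaler_sumr; apply: eq_bigr => D _.
rewrite scaler_sumr; apply: eq_bigr => E _.
by rewrite scalerA ffunE [X in X *: _ = _]mulrCA.
Qed.

Lemma diagM D E : rook_alg_mul (diag D) (diag E) = diag (D * E)%g.
Proof.
rewrite /rook_alg_mul (bigD1 D) //= [X in _ + X]big1 ?addr0 => [|D' neqD].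
  rewrite (bigD1 E) //= big1 ?addr0 => [|E' neqE].
    by rewrite !ffunE !eqxx mulr1 scale1r.
  by rewrite !ffunE (negPf neqE) mulr0 scale0r.
by apply: big1 => E' _; rewrite !ffunE (negPf neqD) mul0r scale0r.
Qed.

Lemma rook_alg_ind (P : rook_alg F n -> Prop) :
  (forall k a b, P a -> P b -> P (k *: a + b)) -> (forall D, P (diag D)) ->
  forall a, P a.
Proof.
move=> Plin Pdiag a; rewrite [a]rook_alg_sum.
elim: (index_enum _) => [|D s IH]; last by rewrite big_cons; apply: Plin.
have := Plin (-1) _ _ (Pdiag 1%g) (Pdiag 1%g).
by rewrite big_nil scaleN1r addNr.
Qed.

Lemma rook_alg_mul_linl k a b c :
  rook_alg_mul (k *: a + b) c = k *: rook_alg_mul a c + rook_alg_mul b c.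
Proof. by rewrite rook_alg_mulDl rook_alg_scaleAl. Qed.

Lemma rook_alg_mul_linr k a b c :
  rook_alg_mul a (k *: b + c) = k *: rook_alg_mul a b + rook_alg_mul a c.
Proof. by rewrite rook_alg_mulDr rook_alg_scaleAr. Qed.

Lemma rook_alg_mulA : associative rook_alg_mul.
Proof.
move=> a b c; elim/rook_alg_ind: a => [k x y IHx IHy | D].
  by rewrite !rook_alg_mul_linl IHx IHy.
elim/rook_alg_ind: b => [k x y IHx IHy | E].
  by rewrite !(rook_alg_mul_linl, rook_alg_mul_linr) IHx IHy.
elim/rook_alg_ind: c => [k x y IHx IHy | G].
  by rewrite !rook_alg_mul_linr IHx IHy.
by rewrite !diagM mulgA.
Qed.

Lemma rook_alg_mul1 : left_id (diag 1%g) rook_alg_mul.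
Proof.
elim/rook_alg_ind => [k x y IHx IHy | D]; first by rewrite rook_alg_mul_linr IHx IHy.
by rewrite diagM mul1g.
Qed.

Lemma rook_alg_mulr1 : right_id (diag 1%g) rook_alg_mul.
Proof.
elim/rook_alg_ind => [k x y IHx IHy | D]; first by rewrite rook_alg_mul_linl IHx IHy.
by rewrite diagM mulg1.
Qed.

Lemma rook_alg1_neq0 : diag 1%g != 0.
Proof.
apply/eqP => /ffunP /(_ 1%g) /eqP; rewrite !ffunE eqxx.
by rewrite oner_eq0.
Qed.

HB.instance Definition _ := GRing.Zmodule_isNzRing.Build (rook_alg F n)
  rook_alg_mulA rook_alg_mul1 rook_alg_mulr1 rook_alg_mulDl rook_alg_mulDr
  rook_alg1_neq0.
HB.instance Definition _ :=
  GRing.Lmodule_isLalgebra.Build F (rook_alg F n) rook_alg_scaleAl.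
HB.instance Definition _ :=
  GRing.Lalgebra_isAlgebra.Build F (rook_alg F n) rook_alg_scaleAr.

End RookAlgebra.

Arguments diag F {n} D.

Definition rook_alg_widen (F : fieldType) k n (le_kn : (k <= n)%N)
    (a : rook_alg F k) : rook_alg F n :=
  \sum_D a D *: diag F (rook_widen le_kn D).

Section TwoSidedIdeal.
Variable A : pzRingType.

Definition two_sided_ideal (I : A -> Prop) : Prop :=
  [/\ I 0, forall x y, I x -> I y -> I (x + y)
    & forall a x b, I x -> I (a * x * b)].

Definition generated_ideal (y : A) (x : A) : Prop :=
  forall I, two_sided_ideal I -> I y -> I x.

End TwoSidedIdeal.

(* The Coxeter length is the length of a shortest word in the simple   *)
(* transpositions; S ^+ l below is the set of products of l elements of S.    *)

Definition simple_transpositions k : {set 'S_k} :=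
  [set s | [exists i : 'I_k, exists j : 'I_k,
              (j == i.+1 :> nat) && (s == tperm i j)]].

Lemma simple_word_exists k (s : 'S_k) :
  exists l, s \in (simple_transpositions k ^+ l)%g.
Proof.
suff : s \in <<simple_transpositions k>>%g.
  case/gen_prodgP => l [c cS ->]; exists l.
  elim: l c cS => [|l IH] c cS; first by rewrite big_ord0 expg0 inE.
  rewrite big_ord_recl expgS mem_mulg //; exact: (IH (fun i => c (lift ord0 i))).
have [ts -> _] := prod_tpermP s; apply: group_prod => -[i j] _ /=.
have Hlt d : forall i j : 'I_k, (j = i + d.+1 :> nat)%N ->
    tperm i j \in <<simple_transpositions k>>%g.
  elim: d => [|d IH] {}i {}j eij.
    apply: mem_gen; rewrite inE; apply/existsP; exists i; apply/existsP; exists j.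
    by rewrite eij addn1 !eqxx.
  have ltk : (i + d.+1 < k)%N by rewrite (leq_ltn_trans _ (ltn_ord j)) ?eij ?leq_add2l.
  pose x := Ordinal ltk.
  have xj : tperm x j \in <<simple_transpositions k>>%g.
    apply: mem_gen; rewrite inE; apply/existsP; exists x; apply/existsP; exists j.
    by rewrite eij /= -addnS !eqxx.
  have -> : tperm i j = (tperm i x ^ tperm x j)%g.
    rewrite tpermJ tpermL tpermD //; apply/eqP => /(congr1 val) /=.
      by move/eqP; rewrite -{2}[val i]addn0 eqn_add2l.
    by rewrite eij => /eqP; rewrite -{2}[val i]addn0 eqn_add2l.
  by rewrite groupJ // (IH i x).
have [ltij|ltji|/val_inj <-] := ltngtP (val i) (val j).
- by apply: (Hlt (val j - (val i).+1)%N); rewrite addnS -addSn subnKC.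
- rewrite tpermC; apply: (Hlt (val i - (val j).+1)%N).
  by rewrite addnS -addSn subnKC.
- by rewrite tperm1 group1.
Qed.

Definition coxeter_length k (s : 'S_k) : nat := ex_minn (simple_word_exists s).

(* Since vertices are numbered from 0, the blocks {1..r} and {r+1..k} become  *)
(* [pred i | i < r] and [pred i | r <= i].                                    *)
Definition block_increasing k r (d : 'S_k) : bool :=
  [forall i : 'I_k, forall j : 'I_k,
     (i < j)%N && ((j < r)%N || (r <= i)%N) ==> (d i < d j)%N].

Definition rook_decomp k (D : rook k)
    (x : 'I_k.+1 * 'S_k * 'S_k * 'S_k) : bool :=
  let: (r, d1, s, d2) := x in
  [&& block_increasing r d1, block_increasing r d2,
      perm_on [set j : 'I_k | (r <= j)%N] s
    & D == (rook_perm d1^-1 * \prod_(j < k | (j < r)%N) rook_p j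
            * rook_perm s * rook_perm d2)%g].

(* By rook_decomp_ex and rook_decomp_uniq below, the decomposition of D       *)
(* exists and is unique: the None case never occurs.                          *)
Definition rook_sgn k (D : rook k) : int :=
  if [pick x | rook_decomp D x] is Some (r, d1, s, d2) then
    (-1) ^+ (r + (coxeter_length d1 + coxeter_length s + coxeter_length d2))
  else 0.

Section Decomposition.
Variable k : nat.
Implicit Types (D : rook k) (d s : 'S_k) (r : nat).

Lemma block_increasingP r d :
  reflect (forall i j : 'I_k, (i < j)%N -> (j < r)%N || (r <= i)%N ->
             (d i < d j)%N) (block_increasing r d).
Proof.
apply: (iffP forallP) => [H i j ij rij | H i].
  by have /forallP/(_ j)/implyP := H i; apply; rewrite ij.
by apply/forallP => j; apply/implyP => /andP[]; apply: H.
Qed.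

Lemma increasing_imset_eq (A : {set 'I_k}) d d' :
  {in A &, forall i j : 'I_k, (i < j)%N -> (d i < d j)%N} ->
  {in A &, forall i j : 'I_k, (i < j)%N -> (d' i < d' j)%N} ->
  d @: A = d' @: A -> {in A, d =1 d'}.
Proof.
move=> incd incd' eqA i; have [N] := ubnP (val i); elim: N i => // N IH i ltiN iA.
have step (f g : 'S_k) : {in A &, forall i j : 'I_k, (i < j)%N -> (g i < g j)%N} ->
    f @: A = g @: A -> (forall j : 'I_k, (j < i)%N -> j \in A -> f j = g j) ->
    ~ (f i < g i)%N.
  move=> incg fgA eqfg lt_fg; have : f i \in g @: A by rewrite -fgA imset_f.
  case/imsetP => j jA fij; have [ltji|ltij|/val_inj eji] := ltngtP (val j) (val i).
  - have := eqfg _ ltji jA; rewrite -fij => /perm_inj eji.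
    by rewrite eji ltnn in ltji.
  - by have := incg _ _ iA jA ltij; rewrite -fij ltnNge ltnW.
  - by rewrite fij eji ltnn in lt_fg.
have IHi (j : 'I_k) : (j < i)%N -> j \in A -> d j = d' j.
  by move=> ltji; apply: IH; apply: leq_trans ltji _.
apply: val_inj; have [ltd|ltd|//] := ltngtP (val (d i)) (val (d' i)).
  by case: (step d d').
exfalso; by apply: (step d' d) => // j ji jA; apply/esym/IHi.
Qed.

Lemma block_increasing_eq r d d' :
  block_increasing r d -> block_increasing r d' ->
  d @: [set i : 'I_k | (i < r)%N] = d' @: [set i : 'I_k | (i < r)%N] -> d = d'.
Proof.
move=> /block_increasingP Hd /block_increasingP Hd' eqA.
set A := [set i : 'I_k | _] in eqA.
have eqC : d @: (~: A) = d' @: (~: A).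
  have imC (f : 'S_k) : f @: (~: A) = ~: (f @: A).
    apply/setP => x; rewrite -[x](permKV f) !inE !(mem_imset _ _ perm_inj).
    by rewrite !inE.
  by rewrite !imC eqA.
apply/permP => i; have [iA|iA] := boolP (i \in A).
  apply: (increasing_imset_eq _ _ eqA) => // x y _; rewrite inE => yr xy.
    by apply: Hd; rewrite ?yr.
  by apply: Hd'; rewrite ?yr.
apply: (increasing_imset_eq _ _ eqC); last by rewrite inE.
  by move=> x y; rewrite !inE -leqNgt => xr _ xy; apply: Hd; rewrite ?xr ?orbT.
by move=> x y; rewrite !inE -leqNgt => xr _ xy; apply: Hd'; rewrite ?xr ?orbT.
Qed.

Lemma sorted_enum_ord (A : {set 'I_k}) :
  sorted (fun i j : 'I_k => (i < j)%N) (enum A).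
Proof.
rewrite /enum_mem; apply: sorted_filter; first by move=> x y z; apply: ltn_trans.
have : sorted ltn [seq val i | i <- enum 'I_k].
  by rewrite val_enum_ord iota_ltn_sorted.
by rewrite sorted_map enumT.
Qed.

Lemma block_increasing_ex (A : {set 'I_k}) :
  exists2 d, block_increasing #|A| d & d @: [set i : 'I_k | (i < #|A|)%N] = A.
Proof.
pose s := enum A ++ enum (~: A).
have szs : size s = k by rewrite size_cat -!cardE cardsC card_ord.
have us : uniq s.
  rewrite cat_uniq !enum_uniq andbT /=; apply/hasPn => x.
  by rewrite !mem_enum inE.
have f_inj : injective (fun i : 'I_k => nth i s i).
  move=> i j /= eqij; apply/val_inj/eqP.
  rewrite -(nth_uniq i _ _ us) ?szs ?ltn_ord //= eqij.
  by apply/eqP/set_nth_default; rewrite szs.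
pose d := perm f_inj.
have dE (x i : 'I_k) : d i = nth x s i.
  by rewrite permE; apply/set_nth_default; rewrite szs.
have trl : transitive (fun i j : 'I_k => (i < j)%N).
  by move=> x y z; apply: ltn_trans.
have szA : size (enum A) = #|A| by rewrite cardE.
have szC : size (enum (~: A)) = (k - #|A|)%N.
  by rewrite -cardE cardsCs setCK card_ord.
exists d.
  apply/block_increasingP => i j ij rij; rewrite (dE i i) (dE i j) !nth_cat szA.
  case: ltnP rij => [jA _|jA] /=.
    rewrite (ltn_trans ij jA).
    apply: (sorted_ltn_nth trl _ (sorted_enum_ord A)) => //; rewrite inE szA //.
    exact: ltn_trans jA.
  move=> iA; have -> : (i < #|A|)%N = false by rewrite ltnNge iA.
  apply: (sorted_ltn_nth trl _ (sorted_enum_ord (~: A))).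
  - by rewrite inE szC ltn_sub2r // (leq_ltn_trans jA).
  - by rewrite inE szC ltn_sub2r // (leq_ltn_trans jA).
  - by rewrite ltn_sub2r // (leq_ltn_trans iA).
apply/eqP; rewrite eqEcard card_imset; last exact: perm_inj.
apply/andP; split.
  apply/subsetP => x /imsetP[i + ->]; rewrite inE (dE i) nth_cat szA => iA.
  by rewrite iA -mem_enum mem_nth ?szA.
have leA : (#|A| <= k)%N by rewrite -[X in (_ <= X)%N]card_ord max_card.
rewrite -[X in (X <= _)%N]card_ord.
rewrite -(card_image (f := widen_ord leA)) ?subset_leq_card //; last first.
  by move=> i j /(congr1 val) eij; apply: val_inj.
by apply/subsetP => x /imageP[i _ ->]; rewrite inE /= ltn_ord.
Qed.

Lemma prod_rook_pP (P : pred 'I_k) i j :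
  ((i, j) \in edges (\prod_(l < k | P l) rook_p l)%g) = (i == j) && ~~ P i.
Proof.
suff H (s : seq 'I_k) : ((i, j) \in edges (\prod_(l <- s | P l) rook_p l)%g)
     = (i == j) && ~~ (P i && (i \in s)).
  by rewrite H mem_index_enum andbT.
elim: s => [|l s IH]; first by rewrite big_nil inE /= perm1 andbF andbT eq_sym.
rewrite big_cons in_cons; case: ifP => Pl; last first.
  by rewrite IH; have [il|] := eqVneq i l; rewrite // il Pl.
apply/concat_edgesP/idP => [[x]|/andP[/eqP eij nP]].
  rewrite inE /= => /andP[/eqP<- il] ij.
  by move: ij; rewrite IH (negPf il).
case: _ / eij in IH nP *.
exists i; last by rewrite IH eqxx; apply: contra nP => /andP[-> ->]; rewrite orbT.
by rewrite inE eqxx /=; apply: contra nP => /eqP ->; rewrite Pl eqxx.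
Qed.

Lemma rook_decompP r d1 s d2 i j :
  ((i, j) \in edges (rook_perm d1^-1 * \prod_(j < k | (j < r)%N) rook_p j
                     * rook_perm s * rook_perm d2)%g)
  = (r <= (d1^-1 i)%g)%N && (j == d2 (s ((d1^-1)%g i))).
Proof.
apply/concat_edgesP/andP => [[c]|[ri /eqP ->]].
  case/concat_edgesP => b /concat_edgesP[a]; rewrite inE /= => /eqP ->.
  rewrite prod_rook_pP -leqNgt => /andP[/eqP <- ->].
  by rewrite !inE /= => /eqP -> /eqP ->.
exists (s ((d1^-1)%g i)); last by rewrite inE.
apply/concat_edgesP; exists ((d1^-1)%g i); last by rewrite inE.
apply/concat_edgesP; exists ((d1^-1)%g i); first by rewrite inE.
by rewrite prod_rook_pP eqxx -leqNgt.
Qed.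

Lemma card_isolated D : #|isolated_top D| = #|isolated_bot D|.
Proof.
have /is_rookP RD := edgesP D.
have E1 : ~: isolated_top D = [set e.1 | e in edges D].
  apply/setP => i; rewrite !inE negb_forall; apply/existsP/imsetP.
    by case=> j; rewrite negbK; exists (i, j).
  by case=> -[i' j] ij -> /=; exists j; rewrite negbK.
have E2 : ~: isolated_bot D = [set e.2 | e in edges D].
  apply/setP => j; rewrite !inE negb_forall; apply/existsP/imsetP.
    by case=> i; rewrite negbK; exists (i, j).
  by case=> -[i j'] ij -> /=; exists i; rewrite negbK.
apply: (@addIn #|edges D|).
have <- : #|~: isolated_top D| = #|edges D|.
  rewrite E1 card_in_imset // => -[i j] [i' j'] ij ij' /= eii'.
  by apply: RD => //; left.
rewrite cardsC.
have -> : #|~: isolated_top D| = #|~: isolated_bot D|.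
  rewrite E1 E2 !card_in_imset // => -[i j] [i' j'] ij ij' /= e.
    by apply: RD => //; right.
  by apply: RD => //; left.
by rewrite cardsC.
Qed.

Lemma rook_decomp_ex D : exists x, rook_decomp D x.
Proof.
have /is_rookP RD := edgesP D.
have [d1 inc1 im1] := block_increasing_ex (isolated_top D).
have [d2 inc2 im2] := block_increasing_ex (isolated_bot D).
set r := #|isolated_top D| in inc1 im1; rewrite -card_isolated -/r in inc2 im2.
pose f i := odflt i [pick j | (i, j) \in edges D].
have fP i : i \notin isolated_top D -> (i, f i) \in edges D.
  rewrite inE negb_forall /f => /existsP[j]; rewrite negbK => ij.
  by case: pickP => //= /(_ j); rewrite ij.
have topE (j : 'I_k) : (d1 j \in isolated_top D) = (j < r)%N.
  by rewrite -im1 (mem_imset _ _ perm_inj) inE.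
have botE (j : 'I_k) : (d2 j \in isolated_bot D) = (j < r)%N.
  by rewrite -im2 (mem_imset _ _ perm_inj) inE.
pose g (j : 'I_k) := if (j < r)%N then j else (d2^-1)%g (f (d1 j)).
have gr (j : 'I_k) : (r <= j)%N -> (r <= g j)%N.
  move=> rj; rewrite /g ltnNge rj /= leqNgt -botE permKV inE negb_forall.
  by apply/existsP; exists (d1 j); rewrite negbK fP // topE -leqNgt.
have g_inj : injective g.
  move=> i j; have [ir|ri] := ltnP i r; have [jr|rj] := ltnP j r.
  - by rewrite /g ir jr.
  - by move=> e; have := gr _ rj; rewrite -e {1}/g ir leqNgt ir.
  - by move=> e; have := gr _ ri; rewrite e {1}/g jr leqNgt jr.
  rewrite /g !ltnNge ri rj /= => /perm_inj e; apply: (@perm_inj _ d1).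
  have fi : (d1 i, f (d1 i)) \in edges D by apply: fP; rewrite topE -leqNgt.
  have fj : (d1 j, f (d1 j)) \in edges D by apply: fP; rewrite topE -leqNgt.
  by have [-> _] := RD _ _ _ _ fi fj (or_intror e).
have rk : (r < k.+1)%N by rewrite ltnS -[X in (_ <= X)%N]card_ord max_card.
exists (Ordinal rk, d1, perm g_inj, d2); apply/and4P; split => //=.
  apply/subsetP => i; rewrite !inE permE /g.
  by case: (ltnP i r) => //; rewrite eqxx.
apply/eqP/edges_inj/setP => -[i j]; rewrite rook_decompP (permE g_inj) /=.
rewrite -[i in LHS](permKV d1); set x := (d1^-1)%g i.
rewrite /g; case: leqP => rx /=; last first.
  apply/negbTE; have : d1 x \in isolated_top D by rewrite topE.
  by rewrite inE => /forallP/(_ j).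
rewrite (permKV d2); have fx : (d1 x, f (d1 x)) \in edges D.
  by apply: fP; rewrite topE -leqNgt.
apply/idP/eqP => [ij|-> //].
by have [] := RD _ _ _ _ ij fx (or_introl erefl).
Qed.

Lemma rook_decomp_uniq D x y : rook_decomp D x -> rook_decomp D y -> x = y.
Proof.
have top (r : 'I_k.+1) d1 s d2 : rook_decomp D (r, d1, s, d2) ->
    d1 @: [set i : 'I_k | (i < r)%N] = isolated_top D.
  case/and4P => _ _ _ /eqP eD; apply/setP => i.
  rewrite -{1}[i](permKV d1) (mem_imset _ _ perm_inj) !inE.
  apply/idP/forallP => [ir j | /(_ (d2 (s ((d1^-1)%g i))))].
    by rewrite eD rook_decompP leqNgt ir.
  by rewrite eD rook_decompP eqxx andbT ltnNge.
have bot (r : 'I_k.+1) d1 s d2 : rook_decomp D (r, d1, s, d2) ->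
    d2 @: [set i : 'I_k | (i < r)%N] = isolated_bot D.
  case/and4P => _ _ sr /eqP eD; apply/setP => j.
  rewrite -{1}[j](permKV d2) (mem_imset _ _ perm_inj) !inE.
  set y' := (d2^-1)%g j; have ej : j = d2 y' by rewrite permKV.
  have sE z : (s z < r)%N = (z < r)%N.
    by have := perm_closed z sr; rewrite !inE !ltnNge => ->.
  apply/idP/forallP => [jr i | /(_ (d1 ((s^-1)%g y')))].
    rewrite eD rook_decompP; apply/negP => /andP[+ /eqP e].
    move: e; rewrite ej => /perm_inj e.
    by rewrite leqNgt -sE -e jr.
  by rewrite eD rook_decompP permK permKV -ej eqxx andbT -ltnNge -(sE ((s^-1)%g y')) permKV.
move: x y => [[[r d1] s] d2] [[[r' d1'] s'] d2'] Dx Dy.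
have rE (q : 'I_k.+1) e1 t e2 : rook_decomp D (q, e1, t, e2) ->
    val q = #|isolated_top D|.
  move=> /top <-; rewrite card_imset; last exact: perm_inj.
  have lek : (q <= k)%N by rewrite -ltnS.
  rewrite -[LHS]card_ord -(card_imset _ (f := widen_ord lek)); last first.
    by move=> i j /(congr1 val) eij; apply: val_inj.
  apply: eq_card => i; rewrite inE; apply/imsetP/idP => [[j _ ->] //=|iq].
  by exists (Ordinal iq) => //; apply: val_inj.
have er : r = r' by apply: val_inj; rewrite (rE _ _ _ _ Dx) (rE _ _ _ _ Dy).
case: _ / er in Dy *.
have e1 := top _ _ _ _ Dx; rewrite -(top _ _ _ _ Dy) in e1.
have e2 := bot _ _ _ _ Dx; rewrite -(bot _ _ _ _ Dy) in e2.
case/and4P: Dx => i1 i2 sr /eqP eD; case/and4P: Dy => i1' i2' sr' /eqP eD'.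
have E1 := block_increasing_eq i1 i1' e1.
have E2 := block_increasing_eq i2 i2' e2.
congr (_, _, _, _) => //; apply/permP => i.
have [ir|ri] := ltnP i r.
  by rewrite (out_perm sr) ?(out_perm sr') // inE -ltnNge.
have : (d1 i, d2 (s i)) \in edges D by rewrite eD rook_decompP permK ri eqxx.
by rewrite eD' rook_decompP -E1 -E2 permK => /andP[_ /eqP /perm_inj].
Qed.

Lemma rook_sgnE D (r : 'I_k.+1) d1 s d2 : rook_decomp D (r, d1, s, d2) ->
  rook_sgn D
    = (-1) ^+ (r + (coxeter_length d1 + coxeter_length s + coxeter_length d2)).
Proof.
rewrite /rook_sgn => Dx; case: pickP => [y Dy|/(_ (r, d1, s, d2))].
  by rewrite (rook_decomp_uniq Dy Dx).
by rewrite Dx.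
Qed.

End Decomposition.

Definition one_isolated k (D : rook k) : bool :=
  (#|isolated_top D| == 1)%N && (#|isolated_bot D| == 1)%N.

Definition antisymmetrizer (F : fieldType) k : rook_alg F k :=
  \sum_(s : 'S_k) (-1) ^+ s *: diag F (rook_perm s)
  + \sum_(D : rook k | one_isolated D) (rook_sgn D)%:~R *: diag F D.

(* The tensor power is characterized up to isomorphism by its universal       *)
(* property.                                                                  *)

Section TensorPower.
Variables (F : fieldType) (n : nat) (U : lmodType F).

Definition replace (u : {ffun 'I_n -> U}) (i : 'I_n) (x : U) :
    {ffun 'I_n -> U} :=
  [ffun l => if l == i then x else u l].

Definition multilinear (W : lmodType F) (f : {ffun 'I_n -> U} -> W) : Prop :=
  forall u i (c : F) x y,
    f (replace u i (c *: x + y)) = c *: f (replace u i x) + f (replace u i y).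

Definition tensor_power (T : lmodType F) (tens : {ffun 'I_n -> U} -> T) : Prop :=
  multilinear tens /\
  forall (W : lmodType F) (f : {ffun 'I_n -> U} -> W), multilinear f ->
    exists g : {linear T -> W}, (forall u, g (tens u) = f u) /\
      forall h : {linear T -> W}, (forall u, h (tens u) = f u) -> h =1 g.

End TensorPower.

(* The basis (v0, 0), (0, v_1), ..., (0, v_m) of F (+) V *)
Definition sum_basis (F : fieldType) (V : vectType F) m (v0 : F^o)
    (v : m.-tuple V) (i : 'I_m.+1) : F^o * V :=
  if unlift ord0 i is Some k then (0, tnth v k) else (v0, 0).

Section RookAction.
Variables (F : fieldType) (n m : nat) (U T : lmodType F).

Record left_action (act : rook_alg F n -> T -> T) : Prop := LeftAction {
  left_actionDl : forall (c : F) a b x,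
    act (c *: a + b) x = c *: act a x + act b x;
  left_actionDr : forall (c : F) a x y,
    act a (c *: x + y) = c *: act a x + act a y;
  left_action1 : forall x, act 1 x = x;
  left_actionM : forall a b x, act (a * b) x = act a (act b x)
}.

(* e 0, ..., e m is the basis of U *)
Record rook_action (tens : {ffun 'I_n -> U} -> T) (e : 'I_m.+1 -> U)
    (act : rook_alg F n -> T -> T) : Prop := RookAction {
  rook_action_left : left_action act;
  rook_action_s : forall (j k : 'I_n) u, k = j.+1 :> nat ->
    act (diag F (rook_perm (tperm j k))) (tens u)
      = tens [ffun l => u (tperm j k l)];
  rook_action_p : forall (j : 'I_n) (i : 'I_n -> 'I_m.+1),
    act (diag F (rook_p j)) (tens [ffun l => e (i l)])
      = (i j == ord0)%:R *: tens [ffun l => if l == j then e ord0 else e (i l)]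
}.

Definition annihilator (act : rook_alg F n -> T -> T) (a : rook_alg F n) : Prop :=
  forall x, act a x = 0.

End RookAction.

(* rook_action_ex below: tensor_power and rook_action are satisfiable. The    *)
(* action is unique because the s_i and the p_j generate R_n.                 *)

Section Existence.
Variables (F : fieldType) (n m : nat) (U : lmodType F).
Variables (e : 'I_m.+1 -> U) (c : 'I_m.+1 -> U -> F).
Hypothesis c_lin : forall i (k : F) x y, c i (k *: x + y) = k * c i x + c i y.
Hypothesis c_sum : forall u, u = \sum_i c i u *: e i.
Hypothesis c_e : forall i j, c i (e j) = (i == j)%:R.

Let I := {ffun 'I_n -> 'I_m.+1}.
Let T : lmodType F := {ffun I -> F^o}.
Let be (f : I) : {ffun 'I_n -> U} := [ffun l => e (f l)].
Let tens (u : {ffun 'I_n -> U}) : T := [ffun f : I => \prod_l c (f l) (u l)].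

Lemma replace_id (u : {ffun 'I_n -> U}) i : replace u i (u i) = u.
Proof. by apply/ffunP => l; rewrite ffunE; case: eqVneq => [->|]. Qed.

Lemma multilinear_sum (W : lmodType F) (G : {ffun 'I_n -> U} -> W) u i
    (s : seq 'I_m.+1) (k : 'I_m.+1 -> F) : multilinear G ->
  G (replace u i (\sum_(j <- s) k j *: e j))
  = \sum_(j <- s) k j *: G (replace u i (e j)).
Proof.
move=> linG; elim: s => [|j s IH]; last by rewrite !big_cons linG IH.
rewrite !big_nil; have := linG u i (-1) 0 0.
by rewrite scaler0 addr0 scaleN1r addNr.
Qed.

Lemma multilinear_ext (W : lmodType F) (G H : {ffun 'I_n -> U} -> W) :
  multilinear G -> multilinear H -> (forall f, G (be f) = H (be f)) -> G =1 H.
Proof.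
move=> linG linH eqGH.
have key k (u : {ffun 'I_n -> U}) (f : I) :
    (forall l : 'I_n, (k <= l)%N -> u l = e (f l)) -> G u = H u.
  elim: k u f => [|k IH] u f uf.
    suff -> : u = be f by [].
    by apply/ffunP => l; rewrite ffunE uf.
  have [kn|nk] := ltnP k n; last first.
    apply: (IH u f) => l kl.
    by have := leq_trans (leq_trans (ltn_ord l) nk) kl; rewrite ltnn.
  pose i := Ordinal kn; rewrite -(replace_id u i) (c_sum (u i)).
  rewrite !multilinear_sum //; apply: eq_bigr => j _; congr (_ *: _).
  apply: (IH _ [ffun l => if l == i then j else f l]) => l kl.
  rewrite !ffunE; case: eqVneq => // li; apply: uf.
  by rewrite ltn_neqAle kl andbT eq_sym; apply: contraNneq li => lk; apply/eqP/val_inj.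
move=> u; apply: (key n u [ffun=> ord0]) => l.
by rewrite leqNgt ltn_ord.
Qed.

Let delta (f : I) : T := [ffun g => (g == f)%:R].

Lemma tens_be f : tens (be f) = delta f.
Proof.
apply/ffunP => g; rewrite !ffunE; case: eqVneq => [->|neq].
  by apply: big1 => l _; rewrite ffunE c_e eqxx.
have /existsP[l nl] : [exists l, g l != f l].
  rewrite -negb_forall; apply: contra neq => /forallP H.
  by apply/eqP/ffunP => l; apply/eqP.
by rewrite (bigD1 l) //= ffunE c_e (negPf nl) mul0r.
Qed.

Lemma delta_sum (t : T) : t = \sum_f t f *: delta f.
Proof.
apply/ffunP => f; rewrite sum_ffunE (bigD1 f) //= big1 => [|g neq].
  by rewrite addr0 !ffunE eqxx /GRing.scale /= mulr1.
by rewrite !ffunE eq_sym (negPf neq) scaler0.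
Qed.

Lemma tens_replace u i x f :
  tens (replace u i x) f = c (f i) x * \prod_(l | l != i) c (f l) (u l).
Proof.
rewrite ffunE (bigD1 i) //= ffunE eqxx; congr (_ * _).
by apply: eq_bigr => l /negPf nl; rewrite ffunE nl.
Qed.

Lemma tens_multilinear : multilinear tens.
Proof.
move=> u i k x y; apply/ffunP => f; rewrite tens_replace c_lin mulrDl -mulrA.
by rewrite -!tens_replace [RHS]ffunE; congr (_ + _); rewrite [RHS]ffunE.
Qed.

Lemma tens_tensor_power : tensor_power tens.
Proof.
split=> [|W G linG]; first exact: tens_multilinear.
pose g (t : T) : W := \sum_f t f *: G (be f).
have g_lin : linear g.
  move=> k x y; rewrite /g scaler_sumr -big_split; apply: eq_bigr => f _ /=.
  by rewrite !ffunE scalerDl scalerA.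
pose gL : {linear T -> W} := HB.pack g (GRing.isLinear.Build _ _ _ _ g g_lin).
have gdelta f : g (delta f) = G (be f).
  rewrite /g (bigD1 f) //= big1 => [|f' neq].
    by rewrite ffunE eqxx scale1r addr0.
  by rewrite ffunE (negPf neq) scale0r.
exists gL; split=> [|h hG t].
  apply: multilinear_ext => // [u i k x y|f]; last by rewrite /= tens_be gdelta.
  by rewrite tens_multilinear linearP.
rewrite [t]delta_sum !linear_sum; apply: eq_bigr => f _.
by rewrite !linearZ /= -{1}tens_be hG gdelta.
Qed.

(* D (v_{i_1} (x) ... (x) v_{i_n}) is the sum of the basis tensors f such     *)
(* that f vanishes on isolated_top D and pullback D f = i.                    *)
Let ok (D : rook n) (f : I) :=
  [forall l, (l \in isolated_top D) ==> (f l == ord0)].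
Let pullback (D : rook n) (f : I) : I :=
  [ffun j => if [pick l | (l, j) \in edges D] is Some l then f l else ord0].
Let ract D (t : T) : T := [ffun f => (ok D f)%:R * t (pullback D f)].

Lemma pullbackE D f l j : (l, j) \in edges D -> pullback D f j = f l.
Proof.
have /is_rookP RD := edgesP D.
move=> lj; rewrite ffunE; case: pickP => [l' l'j|/(_ l)]; last by rewrite lj.
by have [->] := RD _ _ _ _ lj l'j (or_intror erefl).
Qed.

Lemma pullback0 D f j : (forall l, (l, j) \notin edges D) -> pullback D f j = ord0.
Proof.
by move=> nj; rewrite ffunE; case: pickP => // l; rewrite (negPf (nj l)).
Qed.

Lemma pullbackP D f j :
  (exists2 l, (l, j) \in edges D & pullback D f j = f l) \/
  (forall l, (l, j) \notin edges D) /\ pullback D f j = ord0.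
Proof.
have [/existsP[l lj]|] := boolP [exists l, (l, j) \in edges D].
  by left; exists l => //; apply: pullbackE.
by rewrite negb_exists => /forallP nj; right; split=> //; apply: pullback0.
Qed.

Lemma pullbackM D E f : pullback (D * E)%g f = pullback E (pullback D f).
Proof.
apply/ffunP => j; case: (pullbackP E (pullback D f) j) => [[x xj ->]|[nj ->]].
  case: (pullbackP D f x) => [[l lx ->]|[nx ->]].
    by apply: pullbackE; apply/concat_edgesP; exists x.
  apply: pullback0 => l; apply/negP => /concat_edgesP[y ly yj].
  have /is_rookP RE := edgesP E.
  have [exy] := RE _ _ _ _ yj xj (or_intror erefl).
  by move: ly; rewrite exy (negPf (nx l)).
apply: pullback0 => l; apply/negP => /concat_edgesP[y _ yj].
by rewrite (negPf (nj y)) in yj.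
Qed.

Lemma okM D E f : ok (D * E)%g f = ok D f && ok E (pullback D f).
Proof.
have /is_rookP RD := edgesP D.
apply/forallP/andP => [H|[/forallP HD /forallP HE] l].
  split; apply/forallP => l; apply/implyP; rewrite inE => /forallP li.
    apply: (implyP (H l)); rewrite inE; apply/forallP => j.
    by apply/negP => /concat_edgesP[x]; rewrite (negPf (li x)).
  case: (pullbackP D f l) => [[x xl ->]|[_ -> //]].
  apply: (implyP (H x)); rewrite inE; apply/forallP => j.
  apply/negP => /concat_edgesP[y xy yj].
  have [ey] := RD _ _ _ _ xy xl (or_introl erefl).
  by move: yj; rewrite ey (negPf (li j)).
apply/implyP; rewrite inE => /forallP li.
have [lD|] := boolP (l \in isolated_top D); first exact: (implyP (HD l)).
rewrite inE negb_forall => /existsP[x]; rewrite negbK => lx.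
rewrite -(pullbackE f lx); apply: (implyP (HE x)); rewrite inE.
apply/forallP => j; apply/negP => xj; move/negP: (li j); apply.
by apply/concat_edgesP; exists x.
Qed.

Lemma ok_perm (s : 'S_n) f : ok (rook_perm s) f.
Proof.
apply/forallP => l; apply/implyP; rewrite inE => /forallP/(_ (s l)).
by rewrite inE eqxx.
Qed.

Lemma pullback_perm (s : 'S_n) f l : pullback (rook_perm s) f (s l) = f l.
Proof. by apply: pullbackE; rewrite inE. Qed.

Lemma ractM D E t : ract (D * E)%g t = ract D (ract E t).
Proof.
by apply/ffunP => f; rewrite !ffunE okM pullbackM mulrA -natrM mulnb.
Qed.

Lemma ract1 t : ract 1%g t = t.
Proof.
apply/ffunP => f; rewrite ffunE ok_perm mul1r; congr (t _).
by apply/ffunP => l; rewrite -{1}[l](perm1 l) pullback_perm.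
Qed.

Lemma ract_lin D k x y : ract D (k *: x + y) = k *: ract D x + ract D y.
Proof.
by apply/ffunP => f; rewrite !ffunE mulrDr /GRing.scale /= mulrCA.
Qed.

Let act (a : rook_alg F n) (t : T) : T := \sum_D a D *: ract D t.

Lemma act_diag D t : act (diag F D) t = ract D t.
Proof.
rewrite /act (bigD1 D) //= big1 => [|E neq].
  by rewrite ffunE eqxx scale1r addr0.
by rewrite ffunE (negPf neq) scale0r.
Qed.

Lemma act_linl k a b t : act (k *: a + b) t = k *: act a t + act b t.
Proof.
rewrite /act scaler_sumr -big_split; apply: eq_bigr => D _ /=.
by rewrite !ffunE scalerDl scalerA.
Qed.

Lemma act_linr k a x y : act a (k *: x + y) = k *: act a x + act a y.
Proof.
rewrite /act scaler_sumr -big_split; apply: eq_bigr => D _ /=.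
by rewrite ract_lin scalerDr !scalerA mulrC.
Qed.

Lemma act_left_action : left_action act.
Proof.
split; [exact: act_linl | exact: act_linr | by move=> t; rewrite act_diag ract1 |].
move=> a b t; elim/rook_alg_ind: a => [k x y IHx IHy | D].
  by rewrite mulrDl -scalerAl !act_linl IHx IHy.
elim/rook_alg_ind: b => [k x y IHx IHy | E].
  by rewrite mulrDr -scalerAr !act_linl act_linr IHx IHy.
have -> : diag F D * diag F E = diag F (D * E)%g by apply: diagM.
by rewrite !act_diag ractM.
Qed.

Lemma act_rook_action : rook_action tens e act.
Proof.
split; first exact: act_left_action.
  move=> j k u _; rewrite act_diag; apply/ffunP => f; rewrite !ffunE ok_perm mul1r.
  rewrite (reindex_inj (@perm_inj _ (tperm j k))); apply: eq_bigr => l _ /=.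
  by rewrite pullback_perm ffunE.
move=> j i; rewrite act_diag.
have -> : [ffun l => e (i l)] = be [ffun l => i l].
  by apply/ffunP => l; rewrite !ffunE.
have -> : [ffun l => if l == j then e ord0 else e (i l)]
    = be [ffun l => if l == j then ord0 else i l].
  by apply/ffunP => l; rewrite !ffunE; case: ifP.
rewrite !tens_be; apply/ffunP => f; rewrite !ffunE /GRing.scale /= -!natrM !mulnb.
congr (_ %:R); congr nat_of_bool.
have pj : pullback (rook_p j) f j = ord0.
  by apply: pullback0 => l; rewrite inE /=; case: eqVneq => //= ->; rewrite eqxx.
have pl l : l != j -> pullback (rook_p j) f l = f l.
  by move=> lj; apply: pullbackE; rewrite inE eqxx.
apply/andP/andP => [[/forallP okf /eqP/ffunP pf]|[/eqP ij /eqP/ffunP fE]]; split.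
- by have := pf j; rewrite pj ffunE => <-.
- apply/eqP/ffunP => l; rewrite ffunE; case: eqVneq => [->|lj].
    apply/eqP/(implyP (okf j)); rewrite inE; apply/forallP => l'.
    by rewrite inE /= eqxx andbF.
  by have := pf l; rewrite pl // ffunE.
- apply/forallP => l; apply/implyP; rewrite inE => /forallP/(_ l).
  by rewrite inE /= eqxx /= negbK => /eqP ->; rewrite fE ffunE eqxx.
- apply/eqP/ffunP => l; rewrite [RHS]ffunE; have [->|lj] := eqVneq l j.
    by rewrite pj ij.
  by rewrite pl // fE ffunE (negPf lj).
Qed.

Lemma rook_action_ex_coord : exists (T' : lmodType F)
    (tens' : {ffun 'I_n -> U} -> T') (act' : rook_alg F n -> T' -> T'),
  tensor_power tens' /\ rook_action tens' e act'.
Proof.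
exists T, tens, act; split; [exact: tens_tensor_power | exact: act_rook_action].
Qed.

End Existence.

Lemma rook_action_ex (F : fieldType) n m (V : vectType F) (v0 : F^o)
    (v : m.-tuple V) :
  basis_of {:F^o} [:: v0] -> basis_of {:V} v ->
  exists (T : lmodType F) (tens : {ffun 'I_n -> (F^o * V)%type} -> T)
         (act : rook_alg F n -> T -> T),
    tensor_power tens /\ rook_action tens (sum_basis v0 v) act.
Proof.
move=> bv0 bv.
have v0_neq0 : v0 != 0.
  by have := basis_free bv0; rewrite seq1_free.
pose c (i : 'I_m.+1) (u : (F^o * V)%type) : F :=
  if unlift ord0 i is Some k then coord v k u.2 else (u.1 : F) / v0.
apply: (@rook_action_ex_coord _ _ _ _ _ c) => [i k x y|u|i j].
- rewrite /c; case: unliftP => [l|] _; first by rewrite linearP.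
  by rewrite /= mulrDl mulrA.
- have sumV (s : seq 'I_m) (k : 'I_m -> F) :
      \sum_(i <- s) k i *: ((0, tnth v i) : F^o * V)%type
      = (0, \sum_(i <- s) k i *: tnth v i).
    elim: s => [|i s IH]; rewrite ?big_nil // !big_cons IH.
    by congr pair; rewrite /= scaler0 addr0.
  rewrite big_ord_recl /c /sum_basis unlift_none.
  under eq_bigr => i _ do rewrite liftK.
  rewrite sumV; case: u => a w; congr pair; rewrite /= ?addr0 ?scaler0 ?add0r.
    by rewrite /GRing.scale /= divfK.
  rewrite [LHS](coord_basis bv) ?memvf //; apply: eq_bigr => i _.
  by rewrite (tnth_nth 0).
- rewrite /c /sum_basis; case: unliftP => [k|] ->; case: unliftP => [l|] ->.
  + rewrite /= (tnth_nth 0) coord_free ?(basis_free bv) //.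
    by rewrite (inj_eq lift_inj) eq_sym.
  + by rewrite /= linear0.
  + by rewrite /= mul0r.
  + by rewrite /= divff.
Qed.

(* Main.v *)
From HB Require Import structures.
Require Import Defs.
From mathcomp Require Import all_boot all_order all_algebra all_fingroup.

Set Implicit Arguments.
Unset Strict Implicit.
Unset Printing Implicit Defensive.

Import GRing.Theory.
Local Open Scope ring_scope.

(** Label the basis tensors by functions f from the vertices to 0, ..., m.  A
    diagram D, completed to a permutation s by joining its isolated vertices
    arbitrarily, sends f to [f \o s] if f vanishes at [s l] for every isolated
    top vertex l, and to 0 otherwise ([act_completion]).

    The anti-symmetrizer factors.  A diagram with one isolated vertex in each
    row is [p_l * s] for a unique vertex l and a unique permutation s, and its
    sign is minus the sign of s; hence Y is the alternating sum of the
    permutations of the first m+1 vertices, multiplied on the left by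
    [1 - p_1 - ... - p_(m+1)] ([widened_antisymmetrizerE]).  There are m+1
    labels: if f repeats one on the first m+1 factors, the alternating sum
    kills f; otherwise each label, in particular 0, occurs there exactly once,
    and [1 - p_1 - ... - p_(m+1)] kills every rearrangement of f
    ([antisymmetrizer_annihilates]).

    For the converse, read a diagram as the word of its targets, an isolated
    vertex counting as 0, and order the words lexicographically.  By the easy
    half of the Mirsky-Dilworth theorem there are two kinds of diagrams
    ([layered_or_decreasing]).
    - Some m+1 edges cross each other pairwise.  Moving Y to the tops of these
      edges and multiplying by D gives D plus diagrams that are smaller in the
      lexicographic order: undoing crossings and erasing edges both lower the
      word.  So, modulo the ideal of Y, D is a combination of smaller diagrams
      ([straightens_diag]), and by induction every element is congruent to a
      combination of diagrams of the second kind ([straightening]).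
    - The edges of D can be coloured with 1, ..., m so that edges of the same
      colour do not cross; call D layered.  Layered diagrams act linearly
      independently ([layered_independent]).  Indeed the colouring f of the
      top row, with 0 at the isolated vertices, induces a labelling i of the
      bottom row, and D sends the tensor i to the tensor f.  Any other diagram
      that does so matches vertices with equal labels; since D matches each
      colour class increasingly, D has the smallest word among all of them.
      So the lexicographically largest layered diagram of a combination is the
      only one that contributes to this matrix coefficient.

    An annihilating element is thus congruent modulo the ideal to an
    annihilating combination of layered diagrams, which is 0. *)

(** * Diagrams as partial permutations *)

Section Diagrams.
Variable n : nat.
Implicit Types (D E : rook n) (s t : 'S_n) (i j l : 'I_n).

(** Every diagram is a permutation with some of its edges erased, so that
    permutations and the [rook_p j] are enough to compute with. *)
Definition completes s D : Prop :=
  forall i j, ((i, j) \in edges D) = (i \notin isolated_top D) && (j == s i).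

Lemma decomp_isolated D r d1 s d2 i :
  rook_decomp D (r, d1, s, d2) -> (i \in isolated_top D) = ((d1^-1)%g i < r)%N.
Proof.
case/and4P => _ _ _ /eqP eD.
apply/negb_inj; rewrite -leqNgt inE negb_forall.
apply/existsP/idP => [[k]|ri]; first by rewrite negbK eD rook_decompP => /andP[].
by exists ((d1^-1 * s * d2)%g i); rewrite negbK eD rook_decompP ri !permM eqxx.
Qed.

Lemma decomp_completes D r d1 s d2 :
  rook_decomp D (r, d1, s, d2) -> completes (d1^-1 * s * d2)%g D.
Proof.
move=> Dx i j; rewrite (decomp_isolated _ Dx) -leqNgt !permM.
by case/and4P: Dx => _ _ _ /eqP ->; rewrite rook_decompP.
Qed.

Lemma completion_ex D : exists s, completes s D.
Proof.
have [[[[r d1] s] d2] /decomp_completes] := rook_decomp_ex D.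
by exists (d1^-1 * s * d2)%g.
Qed.

Lemma edges_erase (P : pred 'I_n) s i j :
  ((i, j) \in edges (\prod_(l < n | P l) rook_p l * rook_perm s)%g)
  = ~~ P i && (j == s i).
Proof.
apply/concat_edgesP/andP => [[k]|[nPi /eqP ->]].
  by rewrite prod_rook_pP inE /= => /andP[/eqP <- ->] ->.
by exists i; rewrite ?prod_rook_pP ?inE ?eqxx ?nPi.
Qed.

Lemma completesE s D : completes s D ->
  D = (\prod_(l < n | l \in isolated_top D) rook_p l * rook_perm s)%g.
Proof.
by move=> sD; apply/edges_inj/setP => -[i j]; rewrite edges_erase sD.
Qed.

Lemma edges_pM l D i j :
  ((i, j) \in edges (rook_p l * D)%g) = (i != l) && ((i, j) \in edges D).
Proof.
apply/concat_edgesP/andP => [[k]|[nil ij]].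
  by rewrite inE /= => /andP[/eqP <- ->].
by exists i; rewrite // inE /= eqxx.
Qed.

Lemma edges_permM s D i j :
  ((i, j) \in edges (rook_perm s * D)%g) = ((s i, j) \in edges D).
Proof.
apply/concat_edgesP/idP => [[k]|sij]; first by rewrite inE /= => /eqP ->.
by exists (s i); rewrite // inE.
Qed.

Lemma isolated_top_p_perm l s :
  isolated_top (rook_p l * rook_perm s)%g = [set l].
Proof.
apply/setP => i; rewrite !inE; apply/forallP/eqP => [/(_ (s i))|-> j].
  by rewrite edges_pM inE eqxx andbT negbK => /eqP.
by rewrite edges_pM eqxx.
Qed.

Lemma completes_p_perm l s : completes s (rook_p l * rook_perm s)%g.
Proof. by move=> i j; rewrite isolated_top_p_perm edges_pM !inE. Qed.

(** A permutation is determined by its values at all points but one. *)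
Lemma p_perm_inj l l' s s' :
  (rook_p l * rook_perm s = rook_p l' * rook_perm s')%g -> l = l' /\ s = s'.
Proof.
move=> eqD; have /set1_inj ell : [set l] = [set l'].
  by rewrite -(isolated_top_p_perm l s) eqD isolated_top_p_perm.
split=> //; apply: (mulIg s^-1%g); rewrite mulgV; apply/esym.
apply: (@perm_on_id _ _ [set l]); last by rewrite cards1.
apply/subsetP => i; rewrite !inE permM; apply: contraR => il.
have : (i, s' i) \in edges (rook_p l * rook_perm s)%g.
  by rewrite eqD -ell edges_pM il inE /=.
by rewrite edges_pM il inE /= => /eqP ->; rewrite permK.
Qed.

(** The vertices are shifted by one so that 0 is left for isolated ones; with
    this value, erasing an edge lowers the word of a diagram. *)
Definition target D l : nat :=
  if [pick j | (l, j) \in edges D] is Some j then j.+1 else 0%N.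

Lemma target_edge D l j : (target D l == j.+1) = ((l, j) \in edges D).
Proof.
have /is_rookP RD := edgesP D.
rewrite /target; case: pickP => [k lk|->//]; rewrite eqSS.
apply/eqP/idP => [/val_inj <- //|lj].
by have [->] := RD _ _ _ _ lk lj (or_introl erefl).
Qed.

Lemma target_eq0 D l : (target D l == 0%N) = (l \in isolated_top D).
Proof.
rewrite inE /target; case: pickP => [k lk|nl].
  by apply/esym/negbTE/forallPn; exists k; rewrite negbK.
by apply/esym/forallP => j; rewrite nl.
Qed.

Lemma target_completion s D l : completes s D ->
  target D l = if l \in isolated_top D then 0%N else (s l).+1.
Proof.
move=> sD; apply/eqP; case: ifP => [|/negbT] liso; first by rewrite target_eq0.
by rewrite target_edge sD liso eqxx.
Qed.

Lemma target_p j D l : target (rook_p j * D)%g l = if l == j then 0%N else target D l.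
Proof.
apply/eqP; have [->|lj] := eqVneq l j.
  by rewrite target_eq0 inE; apply/forallP => k; rewrite edges_pM eqxx.
by rewrite /target; under eq_pick => k do rewrite edges_pM lj.
Qed.

Lemma target_perm s D l : target (rook_perm s * D)%g l = target D (s l).
Proof. by rewrite /target; under eq_pick => k do rewrite edges_permM. Qed.

Lemma target_rook_perm s l : target (rook_perm s) l = (s l).+1.
Proof. by apply/eqP; rewrite target_edge inE. Qed.

Lemma target_inj D E : target D =1 target E -> D = E.
Proof.
by move=> eqDE; apply/edges_inj/setP => -[i j]; rewrite -!target_edge eqDE.
Qed.

(** * The lexicographic order on diagrams *)

Definition word D : n.-tuplelexi nat := [tuple target D l | l < n].

Lemma tnth_word D l : tnth (word D) l = target D l.
Proof. by rewrite tnth_mktuple. Qed.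

Lemma word_inj : injective word.
Proof.
by move=> D E eqDE; apply: target_inj => l; rewrite -!tnth_word eqDE.
Qed.

Lemma word_ltP D E :
  reflect (exists2 l : 'I_n, forall l' : 'I_n, (l' < l)%N -> target D l' = target E l'
             & (target D l < target E l)%N)
          (word D < word E)%O.
Proof.
apply: (iffP ltxi_tuplePlt) => -[l eqDE ltDE]; exists l.
- by move=> l' /eqDE; rewrite !tnth_word.
- by move: ltDE; rewrite !tnth_word.
- by move=> l' /eqDE; rewrite !tnth_word.
- by rewrite !tnth_word.
Qed.

Lemma word_p_lt l D : l \notin isolated_top D -> (word (rook_p l * D)%g < word D)%O.
Proof.
move=> nl; apply/word_ltP; exists l => [l' ltl|].
  by rewrite target_p; case: eqVneq ltl => // ->; rewrite ltnn.
by rewrite target_p eqxx lt0n target_eq0.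
Qed.

Lemma word_ind (P : rook n -> Prop) :
  (forall D, (forall E, (word E < word D)%O -> P E) -> P D) -> forall D, P D.
Proof.
move=> IH D; have [N] := ubnP #|[set E | (word E < word D)%O]|.
elim: N D => // N IHN D ltN; apply: IH => E ltED; apply: IHN.
rewrite ltnS in ltN; apply: leq_trans ltN; apply/proper_card/properP; split.
  by apply/subsetP => G; rewrite !inE => /Order.POrderTheory.lt_trans; apply.
by exists E; rewrite !inE // Order.POrderTheory.ltxx.
Qed.

End Diagrams.

(** * Layered diagrams and decreasing chains *)

Section ColourOrChain.
Variables (T : finType) (R : rel T).

(** Mirsky's argument: the elements of A without a predecessor in A form one
    colour class, and a chain among the remaining elements can be prolonged
    downwards. *)
Lemma colouring_or_chain m (A : {set T}) :
  (exists c : T -> nat, (forall x, x \in A -> 0 < c x <= m)%N /\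
     {in A &, forall x y, R x y -> c x <> c y}) \/
  (exists s, [/\ size s = m.+1, sorted R s & {subset s <= A}]).
Proof.
elim: m A => [|m IH] A.
  have [->|[x xA]] := set_0Vmem A.
    by left; exists (fun=> 0%N); split=> [x|x y]; rewrite inE.
  by right; exists [:: x]; split=> // y; rewrite inE => /eqP ->.
case: (IH [set x in A | [exists y in A, R y x]]) => [[c [cm cR]]|[s [szs Rs sA]]].
  left; exists (fun x => if x \in [set x in A | [exists y in A, R y x]] then c x else m.+1).
  split=> [x xA|x y xA yA Rxy].
    by case: ifP => [/cm /andP[-> /leqW]|_] //=; rewrite ?leqnn.
  have yA' : y \in [set x in A | [exists y in A, R y x]].
    by rewrite inE yA; apply/exists_inP; exists x.
  rewrite yA'; case: ifP => [xA'|_]; first exact: cR.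
  by move=> e; have := cm _ yA'; rewrite -e ltnn andbF.
right; case: s szs Rs sA => // x s szs Rs sA.
have := sA x (mem_head _ _); rewrite inE => /andP[_ /exists_inP[y yA Ryx]].
exists (y :: x :: s); split=> /=; [by rewrite -szs | by rewrite Ryx |].
move=> z; rewrite inE => /predU1P[-> //|/sA].
by rewrite inE => /andP[].
Qed.

End ColourOrChain.

(** The edges of one colour are pairwise non-crossing, and the colour 0 marks
    the isolated vertices; m colours are left for the edges. *)
Definition layering n m (f : {ffun 'I_n -> 'I_m.+1}) (D : rook n) : Prop :=
  (forall l, (f l == ord0) = (l \in isolated_top D)) /\
  forall l l' : 'I_n, f l = f l' -> f l != ord0 -> (l < l')%N ->
    (target D l < target D l')%N.

Definition layered n m (D : rook n) : Prop :=
  exists f : {ffun 'I_n -> 'I_m.+1}, layering f D.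

(** This is [colouring_or_chain] for crossings of edges: a set of edges without
    crossings is increasing, because distinct edges have distinct targets. *)
Lemma layered_or_decreasing n m (D : rook n) :
  layered m D \/
  (exists A : {set 'I_n}, [/\ #|A| = m.+1, A \subset ~: isolated_top D &
     {in A &, forall l l' : 'I_n, (l < l')%N -> (target D l' < target D l)%N}]).
Proof.
pose R := [rel l l' : 'I_n | (l < l')%N && (target D l' < target D l)%N].
case: (colouring_or_chain R m (~: isolated_top D)) => [[c [cm cR]]|[s [szs Rs sA]]].
  left; exists [ffun l => if l \in isolated_top D then ord0 else inord (c l)].
  have fE l : l \notin isolated_top D -> (inord (c l) : 'I_m.+1) = c l :> nat /\ (0 < c l)%N.
    by rewrite -in_setC => /cm /andP[c0 lecm]; rewrite inordK.
  split=> [l|l l' + + lt_ll'].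
    rewrite ffunE; case: ifP => [|/negbT/fE[cl c0]]; first by rewrite eqxx.
    by apply/negbTE; rewrite -val_eqE /= cl -lt0n.
  rewrite !ffunE; case: (boolP (l \in _)) => [|nl] //; rewrite ?eqxx //.
  case: (boolP (l' \in _)) => [|nl']; first by move=> _ ->; rewrite eqxx.
  move=> /(congr1 val) /=; have [-> _] := fE l nl; have [-> _] := fE l' nl'.
  move=> ecl _; rewrite ltnNge; apply/negP => le_t.
  have lt_t : (target D l' < target D l)%N.
    rewrite ltn_neqAle le_t andbT; apply/eqP => et.
    have [s sD] := completion_ex D.
    move: et; rewrite !(target_completion _ sD) (negPf nl) (negPf nl').
    by case=> /val_inj/perm_inj ell; rewrite ell ltnn in lt_ll'.
  have := cR l l'; rewrite !in_setC => /(_ nl nl').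
  by rewrite /= lt_ll' lt_t => /(_ isT); apply.
right; have trR : transitive R.
  move=> y x z /= /andP[xy tyx] /andP[yz tzy].
  by rewrite (ltn_trans xy yz) (ltn_trans tzy tyx).
have us : uniq s by apply: (sorted_uniq trR) => // x /=; rewrite ltnn.
exists [set x in s]; split; first by rewrite cardsE (card_uniqP us).
  by apply/subsetP => x; rewrite inE => /sA.
move=> l l'; rewrite !inE => ls ls' lt_ll'.
have := @sorted_ltn_index _ _ trR _ Rs.
case: (ltngtP (index l s) (index l' s)) => [lt_i|lt_i|eq_i] H.
- by have /andP[] := H l l' ls ls' lt_i.
- have /andP[lt_l'l _] := H l' l ls' ls lt_i.
  by have := ltn_trans lt_ll' lt_l'l; rewrite ltnn.
- have ell : l = l' by rewrite -(nth_index l ls) eq_i nth_index.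
  by rewrite ell ltnn in lt_ll'.
Qed.

(** * The anti-symmetrizer as a product *)

Section Antisymmetrizer.
Variable k : nat.
Implicit Types (s : 'S_k) (l : 'I_k).

Lemma odd_coxeter_length s : odd (coxeter_length s) = s.
Proof.
rewrite /coxeter_length; case: ex_minnP => l + _.
elim: l s => [|l IH] s; first by rewrite expg0 => /set1gP ->; rewrite odd_perm1.
rewrite expgS => /mulsgP[t u]; rewrite inE => /existsP[i /existsP[j]].
case/andP=> /eqP ji /eqP -> {}/IH IH ->; rewrite odd_permM odd_tperm -IH /=.
by have -> : i != j; [rewrite -val_eqE /= ji neq_ltn ltnSn | rewrite addTb].
Qed.

(** With one isolated vertex in each row r is 1, so the sign is minus the
    parity of the lengths of the factors d1, sigma and d2, that is minus the
    sign of their product, which is the completion s of the diagram. *)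
Lemma rook_sgn_p_perm l s : rook_sgn (rook_p l * rook_perm s)%g = - (-1) ^+ s.
Proof.
set D := (_ * _)%g; have [[[[r d1] t] d2] Dx] := rook_decomp_ex D.
have es : s = (d1^-1 * t * d2)%g.
  have eD := completesE (decomp_completes Dx).
  by move: eD; rewrite isolated_top_p_perm big_set1 => /p_perm_inj[].
have r1 : r = 1%N :> nat.
  have iso (i : 'I_k) : (i < r)%N = (d1 i == l).
    by rewrite -in_set1 -(isolated_top_p_perm l s) (decomp_isolated _ Dx) permK.
  case: (ltngtP (val r) 1) => [|r_gt1|//].
    rewrite ltnS leqn0 => /eqP r0.
    by have := iso ((d1^-1)%g l); rewrite r0 permKV eqxx.
  have lt1k : (1 < k)%N by apply: (leq_trans r_gt1); have := ltn_ord r; rewrite ltnS.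
  have e1 : d1 (Ordinal lt1k) = l by apply/eqP; rewrite -iso.
  have e0 : d1 (Ordinal (ltnW lt1k)) = l by apply/eqP; rewrite -iso ltnW.
  by have /perm_inj[] : d1 (Ordinal lt1k) = d1 (Ordinal (ltnW lt1k)) by rewrite e0.
rewrite (rook_sgnE Dx) r1 exprD expr1 mulN1r es; congr (- _).
rewrite -signr_odd !oddD !odd_coxeter_length.
by rewrite !odd_permM odd_permV.
Qed.

Lemma one_isolatedE :
  [set D : rook k | one_isolated D]
  = [set (rook_p x.1 * rook_perm x.2)%g | x in [set: 'I_k * 'S_k]].
Proof.
apply/setP => D; rewrite inE /one_isolated -card_isolated andbb.
apply/cards1P/imsetP => [[l eD]|[[l s] _ ->]]; last first.
  by exists l; rewrite isolated_top_p_perm.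
have [s sD] := completion_ex D; exists (l, s); rewrite ?inE //=.
by rewrite [LHS](completesE sD) eD big_set1.
Qed.

Lemma antisymmetrizerE (F : fieldType) :
  antisymmetrizer F k
  = \sum_(s : 'S_k) (-1) ^+ s *: (diag F (rook_perm s)
                         - \sum_l diag F (rook_p l * rook_perm s)%g).
Proof.
under [RHS]eq_bigr => s _ do rewrite scalerBr.
rewrite sumrB; congr (_ + _).
rewrite -(eq_bigl _ _ (fun D => in_set _ D)) one_isolatedE big_imset /=; last first.
  by move=> [l s] [l' s'] _ _ /= /p_perm_inj[-> ->].
under [in RHS]eq_bigr => s _ do rewrite scaler_sumr.
rewrite exchange_big pair_big /= -sumrN; apply: eq_big => [x|[l s] _ /=].
  by rewrite inE.
by rewrite rook_sgn_p_perm rmorphN rmorph_sign scaleNr.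
Qed.

End Antisymmetrizer.

(** * The inclusion of the smaller rook monoid *)

Section Widening.
Variables (k n : nat) (le_kn : (k <= n)%N).
Implicit Types (s t : 'S_k) (j : 'I_k) (i : 'I_n).

Let w : 'I_k -> 'I_n := widen_ord le_kn.

Lemma widen_ord_inj : injective w.
Proof. by move=> i j /(congr1 val) /= /val_inj. Qed.

Lemma widen_ord_cases i : (exists j, i = w j) \/ (k <= i)%N.
Proof.
case: (ltnP i k) => [lt_ik|]; last by right.
by left; exists (Ordinal lt_ik); apply: val_inj.
Qed.

Definition extend_fun s i : 'I_n := oapp (fun j => w (s j)) i (insub (val i)).

Lemma extend_fun_widen s j : extend_fun s (w j) = w (s j).
Proof. by rewrite /extend_fun /= valK. Qed.

Lemma extend_fun_out s i : (k <= i)%N -> extend_fun s i = i.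
Proof. by move=> le_ki; rewrite /extend_fun insubN // -leqNgt. Qed.

Lemma extend_fun_inj s : injective (extend_fun s).
Proof.
apply: (can_inj (g := extend_fun s^-1)) => i.
case: (widen_ord_cases i) => [[j ->]|le_ki]; last by rewrite !extend_fun_out.
by rewrite !extend_fun_widen permK.
Qed.

Definition extend_perm s : 'S_n := perm (@extend_fun_inj s).

Lemma extend_perm_widen s j : extend_perm s (w j) = w (s j).
Proof. by rewrite permE extend_fun_widen. Qed.

Lemma extend_perm_out s i : (k <= i)%N -> extend_perm s i = i.
Proof. by rewrite permE; apply: extend_fun_out. Qed.

Lemma extend_permM s t : extend_perm (s * t)%g = (extend_perm s * extend_perm t)%g.
Proof.
apply/permP => i; rewrite permM.
case: (widen_ord_cases i) => [[j ->]|le_ki]; last by rewrite !extend_perm_out.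
by rewrite !extend_perm_widen permM.
Qed.

Lemma extend_perm1 : extend_perm 1%g = 1%g.
Proof.
apply/permP => i; rewrite perm1.
case: (widen_ord_cases i) => [[j ->]|le_ki]; last by rewrite extend_perm_out.
by rewrite extend_perm_widen perm1.
Qed.

Lemma target_widen (D : rook k) j : target (rook_widen le_kn D) (w j) = target D j.
Proof.
have edge_widen a b : (a, b) \in edges D -> (w a, w b) \in edges (rook_widen le_kn D).
  by move=> ab; rewrite inE; apply/orP; left; apply/imsetP; exists (a, b).
case: (pickP (fun b => (j, b) \in edges D)) => [b jb|nj].
  have -> : target D j = b.+1 by apply/eqP; rewrite target_edge.
  by apply/eqP; rewrite -[b : nat]/(w b : nat) target_edge edge_widen.
have /eqP -> : target D j == 0%N.
  by rewrite target_eq0 inE; apply/forallP => b; rewrite nj.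
apply/eqP; rewrite target_eq0 inE; apply/forallP => i.
rewrite inE negb_or; apply/andP; split; apply/negP => /imsetP[].
  by case=> a b ab [/val_inj ja _]; move: ab; rewrite -ja nj.
by move=> x; rewrite inE /= => le_kx [jx _]; rewrite -jx /= leqNgt ltn_ord in le_kx.
Qed.

Lemma target_widen_out (D : rook k) i :
  (k <= i)%N -> target (rook_widen le_kn D) i = i.+1.
Proof.
move=> le_ki; apply/eqP; rewrite target_edge inE; apply/orP; right.
by apply/imsetP; exists i; rewrite // inE.
Qed.

Lemma rook_widen_perm s : rook_widen le_kn (rook_perm s) = rook_perm (extend_perm s).
Proof.
apply: target_inj => i; rewrite target_rook_perm.
case: (widen_ord_cases i) => [[j ->]|le_ki].
  by rewrite target_widen target_rook_perm extend_perm_widen.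
by rewrite target_widen_out ?extend_perm_out.
Qed.

Lemma rook_widen_p_perm j s :
  rook_widen le_kn (rook_p j * rook_perm s)%g
  = (rook_p (w j) * rook_perm (extend_perm s))%g.
Proof.
apply: target_inj => i; rewrite target_p target_rook_perm.
case: (widen_ord_cases i) => [[l ->]|le_ki].
  rewrite target_widen target_p target_rook_perm extend_perm_widen.
  by rewrite (inj_eq widen_ord_inj).
rewrite target_widen_out ?extend_perm_out // ifN //.
by apply: contraTneq le_ki => ->; rewrite -ltnNge /=.
Qed.

Lemma widened_antisymmetrizerE (F : fieldType) :
  rook_alg_widen le_kn (antisymmetrizer F k)
  = \sum_(s : 'S_k) (-1) ^+ s *: (diag F (rook_perm (extend_perm s))
      - \sum_j diag F (rook_p (w j) * rook_perm (extend_perm s))%g).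
Proof.
have [W WE] : exists W : {linear rook_alg F k -> rook_alg F n},
    forall a, W a = rook_alg_widen le_kn a.
  have lin : linear (@rook_alg_widen F k n le_kn).
    move=> c a b; rewrite /rook_alg_widen scaler_sumr -big_split.
    by apply: eq_bigr => D _; rewrite !ffunE scalerDl scalerA.
  pose widen_mixin := GRing.isLinear.Build _ _ _ _ _ lin.
  pose W : {linear rook_alg F k -> rook_alg F n} :=
    HB.pack (@rook_alg_widen F k n le_kn) widen_mixin.
  by exists W.
have W_diag D : W (diag F D) = diag F (rook_widen le_kn D).
  rewrite WE /rook_alg_widen (bigD1 D) //= big1 => [|E neq].
    by rewrite ffunE eqxx scale1r addr0.
  by rewrite ffunE (negPf neq) scale0r.
rewrite antisymmetrizerE -WE linear_sum; apply: eq_bigr => s _.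
rewrite linearZ_LR linearB linear_sum; congr (_ *: (_ - _)).
  by rewrite W_diag rook_widen_perm.
by apply: eq_bigr => j _; rewrite W_diag rook_widen_p_perm.
Qed.

End Widening.

(** * The action on the tensor power *)

Section Action.
Variables (F : fieldType) (n m : nat) (U T : lmodType F).
Variables (e : 'I_m.+1 -> U) (c : 'I_m.+1 -> U -> F).
Hypothesis c_lin : forall i (k : F) x y, c i (k *: x + y) = k * c i x + c i y.
Hypothesis c_sum : forall u, u = \sum_i c i u *: e i.
Hypothesis c_e : forall i j, c i (e j) = (i == j)%:R.
Variables (tens : {ffun 'I_n -> U} -> T) (act : rook_alg F n -> T -> T).
Hypothesis T_tensor : tensor_power tens.
Hypothesis act_rook : rook_action tens e act.
Implicit Types (D E : rook n) (s t : 'S_n) (f g : 'I_n -> 'I_m.+1).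

Definition basis_tensor f : T := tens [ffun l => e (f l)].

Lemma eq_basis_tensor f g : f =1 g -> basis_tensor f = basis_tensor g.
Proof. by move=> fg; congr tens; apply/ffunP => l; rewrite !ffunE fg. Qed.

Let act_left := rook_action_left act_rook.

(** Packing the two partial applications of [act] as linear maps makes the
    generic lemmas on sums and scalars available. *)
Lemma act_linear_alg x :
  exists L : {linear rook_alg F n -> T}, forall a, L a = act a x.
Proof.
have lin : linear (act^~ x) by move=> k a b; rewrite (left_actionDl act_left).
pose mixin := GRing.isLinear.Build _ _ _ _ _ lin.
pose L : {linear rook_alg F n -> T} := HB.pack (act^~ x) mixin.
by exists L.
Qed.

Lemma act_linear_tensor a : exists L : {linear T -> T}, L =1 act a.
Proof.
have lin : linear (act a) by move=> k x y; rewrite (left_actionDr act_left).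
pose mixin := GRing.isLinear.Build _ _ _ _ _ lin.
pose L : {linear T -> T} := HB.pack (act a) mixin.
by exists L.
Qed.

Lemma act_diagM D E x : act (diag F (D * E)%g) x = act (diag F D) (act (diag F E) x).
Proof. by rewrite -(left_actionM act_left) -diagM. Qed.

Lemma act_perm s f :
  act (diag F (rook_perm s)) (basis_tensor f) = basis_tensor (f \o s).
Proof.
have [l] := simple_word_exists s.
elim: l s f => [|l IH] s f.
  rewrite expg0 => /set1gP ->; rewrite (left_action1 act_left).
  by apply: eq_basis_tensor => i; rewrite /= perm1.
rewrite expgS => /mulsgP[t u]; rewrite inE => /existsP[i /existsP[j]].
case/andP=> /eqP ji /eqP -> /IH {}IH ->.
rewrite rook_permM act_diagM IH (rook_action_s act_rook) //.
by congr tens; apply/ffunP => x; rewrite !ffunE /= permM.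
Qed.

Lemma act_p j f :
  act (diag F (rook_p j)) (basis_tensor f) = (f j == ord0)%:R *: basis_tensor f.
Proof.
rewrite (rook_action_p act_rook); case: eqVneq => [fj|]; last by rewrite !scale0r.
by congr (_ *: tens _); apply/ffunP => l; rewrite !ffunE; case: eqP => // ->; rewrite fj.
Qed.

Lemma act_prod_p (P : pred 'I_n) f :
  act (diag F (\prod_(l < n | P l) rook_p l)%g) (basis_tensor f)
  = [forall l, P l ==> (f l == ord0)]%:R *: basis_tensor f.
Proof.
suff H (r : seq 'I_n) :
    act (diag F (\prod_(l <- r | P l) rook_p l)%g) (basis_tensor f)
    = (all (fun l => P l ==> (f l == ord0)) r)%:R *: basis_tensor f.
  rewrite H; congr ((nat_of_bool _)%:R *: _).
  apply/allP/forallP => Pf l; first by apply: Pf; rewrite mem_index_enum.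
  by move=> _; apply: Pf.
elim: r => [|l r IH]; first by rewrite big_nil (left_action1 act_left) scale1r.
rewrite big_cons /=; case: ifP => Pl //=; rewrite act_diagM IH.
have [L LE] := act_linear_tensor (diag F (rook_p l)).
by rewrite -LE linearZ_LR LE act_p scalerA -natrM mulnb andbC.
Qed.

Lemma act_completion s D f : completes s D ->
  act (diag F D) (basis_tensor f)
  = [forall l in isolated_top D, f (s l) == ord0]%:R *: basis_tensor (f \o s).
Proof.
by move=> sD; rewrite [X in diag F X](completesE sD) act_diagM act_perm act_prod_p.
Qed.

(** The basis tensors span: a linear map that kills them kills every pure
    tensor by multilinearity, so it is 0 by the uniqueness in the universal
    property. *)
Lemma annihilator_basis a :
  (forall f, act a (basis_tensor f) = 0) -> annihilator act a.
Proof.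
move=> a0; have [L LE] := act_linear_tensor a.
have [tens_lin tens_univ] := T_tensor.
have L_tens : (fun u => L (tens u)) =1 (fun=> 0).
  apply: (multilinear_ext c_sum) => [u i k x y|u i k x y|f].
  - by rewrite tens_lin linearP.
  - by rewrite scaler0 addr0.
  - by rewrite LE a0.
have [G [_ Guniq]] : exists G : {linear T -> T}, (forall u, G (tens u) = 0) /\
    forall H : {linear T -> T}, (forall u, H (tens u) = 0) -> H =1 G.
  by apply: tens_univ => u i k x y; rewrite scaler0 addr0.
pose Z : {linear T -> T} := \0.
by move=> x; rewrite -LE (Guniq L L_tens) -(Guniq Z).
Qed.

(** The basis tensors are linearly independent: the universal property turns
    the products of coordinates into linear forms dual to them. *)
Lemma coordinates_ex :
  exists L : {linear T -> {ffun {ffun 'I_n -> 'I_m.+1} -> F^o}},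
    forall f, L (basis_tensor f) = [ffun g => (g == finfun f)%:R].
Proof.
have [_ tens_univ] := T_tensor.
have [L [LE _]] := tens_univ _ _ (tens_multilinear c_lin).
exists L => f; rewrite LE -(tens_be c_e) /=.
by apply/ffunP => g; rewrite !ffunE; apply: eq_bigr => l _; rewrite !ffunE.
Qed.

Section Antisymmetrizer.
Hypothesis lt_mn : (m < n)%N.
Let w : 'I_m.+1 -> 'I_n := widen_ord lt_mn.
Let Y : rook_alg F n := rook_alg_widen lt_mn (antisymmetrizer F m.+1).

(** Multiplying s on the right by the transposition of two factors with equal
    labels pairs the even terms with the odd ones. *)
Lemma alternating_sum0 f j j' : j != j' -> f (w j) = f (w j') ->
  \sum_(s : 'S_m.+1) (-1) ^+ s *: basis_tensor (f \o extend_perm lt_mn s) = 0.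
Proof.
move=> neq_j fjj'; rewrite (bigID (@odd_perm _)) /=.
rewrite [X in X + _](reindex_inj (mulIg (tperm j j'))) /=.
under eq_bigl => s do rewrite odd_permM odd_tperm neq_j addbT.
rewrite -big_split big1 // => s /= even_s.
rewrite odd_permM odd_tperm neq_j (negPf even_s) expr1 expr0 scaleN1r scale1r.
apply/eqP; rewrite addrC subr_eq0; apply/eqP/eq_basis_tensor => i /=.
rewrite extend_permM permM.
case: (widen_ord_cases lt_mn (extend_perm lt_mn s i)) => [[l ->]|le_i].
  rewrite extend_perm_widen.
  by case: tpermP => [->|->|//]; rewrite -/w.
by rewrite (extend_perm_out _ _ le_i).
Qed.

(** Y acts on f by the alternating sum over its rearrangements, scaled by 1
    minus the number z of labels 0 among the first m+1 factors.  This number is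
    1 as soon as the m+1 labels there are distinct. *)
Lemma antisymmetrizer_annihilates : annihilator act Y.
Proof.
apply: annihilator_basis => f.
pose z : F := \sum_j (f (w j) == ord0)%:R.
have [L LE] := act_linear_alg (basis_tensor f).
have LY : L Y = (1 - z) *: \sum_(s : 'S_m.+1)
    (-1) ^+ s *: basis_tensor (f \o extend_perm lt_mn s).
  rewrite /Y widened_antisymmetrizerE linear_sum scaler_sumr.
  apply: eq_bigr => s _; rewrite linearZ_LR linearB linear_sum LE act_perm.
  rewrite scalerA mulrC -scalerA scalerBl scale1r; congr (_ *: (_ - _)).
  rewrite /z [in RHS](reindex_inj (@perm_inj _ s)) /= scaler_suml.
  apply: eq_bigr => j _; rewrite LE act_diagM act_perm.
  by rewrite act_p /= extend_perm_widen.
rewrite -LE LY; have [/injectiveP fw_inj|] := boolP (injectiveb (f \o w)).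
  have -> : z = 1.
    have <- : \sum_(j : 'I_m.+1) (j == ord0)%:R = z by rewrite (reindex_inj fw_inj).
    by rewrite (bigD1 ord0) //= big1 ?addr0 // => j /negPf ->.
  by rewrite subrr scale0r.
case/injectivePn => j [j' neq_j fjj'].
by rewrite (alternating_sum0 neq_j) ?scaler0.
Qed.

End Antisymmetrizer.

(** The lexicographically largest diagram D of the support is detected by one
    matrix coefficient: the row is a layering f of D, and the column is the
    labelling i of the bottom row that D sends to f. *)
Lemma layered_independent a : annihilator act a ->
  (forall D, a D != 0 -> layered m D) -> a = 0.
Proof.
move=> a_ann a_lay; apply/eqP/negPn/negP => a_neq0.
have /existsP[D0 aD0] : [exists D, a D != 0].
  apply: contraNT a_neq0; rewrite negb_exists => /forallP a0.
  by apply/eqP/ffunP => D; rewrite ffunE; apply/eqP/negPn/a0.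
have := @Order.TotalTheory.arg_maxP _ _ _ D0 (fun D => a D != 0) (@word n) aD0.
case=> D aD maxD; have [f [f_iso f_incr]] := a_lay D aD.
have [s sD] := completion_ex D; pose i := f \o (s^-1)%g.
have [L LE] := coordinates_ex; have [M ME] := act_linear_alg (basis_tensor i).
have coefD : L (act (diag F D) (basis_tensor i)) f = 1.
  rewrite (act_completion _ sD).
  have -> : [forall l in isolated_top D, i (s l) == ord0].
    by apply/forall_inP => l; rewrite /i /= permK f_iso.
  rewrite scale1r LE ffunE -[RHS]/(true%:R); congr (_%:R); congr nat_of_bool.
  by apply/eqP/ffunP => l; rewrite ffunE /i /= permK.
have coefE E : E != D -> a E != 0 -> L (act (diag F E) (basis_tensor i)) f = 0.
  move=> neqED aE; have [t tE] := completion_ex E.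
  rewrite (act_completion _ tE).
  case: forall_inP => [iso0|_]; last by rewrite scale0r linear0 ffunE.
  rewrite scale1r LE ffunE; case: eqP => // /ffunP f_it; exfalso.
  have {}f_it l : f l = f ((s^-1)%g (t l)) by rewrite f_it ffunE.
  have isoE l : f l != ord0 -> l \notin isolated_top E.
    by rewrite f_it; apply: contra => /iso0.
  have isoD l : f l != ord0 -> l \notin isolated_top D by rewrite f_iso.
  (* At the first difference l, E goes to a smaller vertex than D.  In D this
     vertex is joined to some l' of the same colour as l: l' < l contradicts
     the agreement of D and E before l, and l < l' the monotonicity of D on
     that colour. *)
  have /word_ltP[l eq_lt lt_l] : (word E < word D)%O.
    rewrite Order.POrderTheory.lt_neqAle (inj_eq (@word_inj n)) neqED /=.
    exact: maxD.
  have fl : f l != ord0.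
    by rewrite f_iso -target_eq0 -lt0n; apply: leq_ltn_trans lt_l.
  pose l' := (s^-1)%g (t l); have fl' : f l' != ord0 by rewrite -f_it.
  have tl : target E l = (t l).+1 by rewrite (target_completion _ tE) ifN ?isoE.
  have tl' : target D l' = (t l).+1.
    by rewrite (target_completion _ sD) ifN ?isoD // permKV.
  case: (ltngtP l' l) => [lt_l'|lt_l'|/val_inj ell].
  - have := eq_lt _ lt_l'; rewrite tl' (target_completion _ tE) ifN ?isoE //.
    by case=> /val_inj/perm_inj ell; rewrite ell ltnn in lt_l'.
  - have := f_incr _ _ (f_it l) fl lt_l'.
    by rewrite -/l' tl' -tl ltnNge ltnW.
  - by rewrite tl -tl' ell ltnn in lt_l.
have : L (M a) f = a D.
  rewrite {1}[a]rook_alg_sum !linear_sum sum_ffunE (bigD1 D) //= big1 => [|E neqED].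
    by rewrite addr0 !linearZ_LR ME ffunE coefD; apply: mulr1.
  rewrite !linearZ_LR ME ffunE; have [->|/(coefE _ neqED) ->] := eqVneq (a E) 0.
    exact: scale0r.
  exact: scaler0.
by rewrite ME a_ann linear0 ffunE => /esym/eqP; rewrite (negPf aD).
Qed.

End Action.

(** * Straightening modulo the ideal of the anti-symmetrizer *)

Section Straightening.
Variables (F : fieldType) (n m : nat) (lt_mn : (m < n)%N).
Let w : 'I_m.+1 -> 'I_n := widen_ord lt_mn.
Let Y : rook_alg F n := rook_alg_widen lt_mn (antisymmetrizer F m.+1).

Lemma diagMr (D E : rook n) : diag F D * diag F E = diag F (D * E)%g.
Proof. exact: diagM. Qed.

(** The tops of m+1 pairwise crossing edges of D are given as the images of
    the first m+1 vertices by a permutation d. *)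
Section Rewiring.
Variables (D : rook n) (d : 'S_n).
Hypothesis d_incr : forall j j' : 'I_m.+1, (j < j')%N -> (d (w j) < d (w j'))%N.
Hypothesis target_pos : forall j, (0 < target D (d (w j)))%N.
Hypothesis D_decr : forall j j' : 'I_m.+1, (j < j')%N ->
  (target D (d (w j')) < target D (d (w j)))%N.

(** The chosen edges keep their bottom ends, and s permutes their tops; the
    other edges of D stay. *)
Definition rewire (s : 'S_m.+1) : rook n :=
  (rook_perm (d^-1 * extend_perm lt_mn s * d)%g * D)%g.

Lemma target_rewire s j : target (rewire s) (d (w j)) = target D (d (w (s j))).
Proof. by rewrite target_perm !permM permK extend_perm_widen. Qed.

Lemma rewire1 : rewire 1%g = D.
Proof.
by apply: target_inj => l; rewrite target_perm extend_perm1 mulg1 mulVg perm1.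
Qed.

(** At the first j that s moves, s j > j; so the words agree before the top
    number j, which receives a smaller target. *)
Lemma rewire_lt s : s != 1%g -> (word (rewire s) < word D)%O.
Proof.
move=> s_neq1; have /existsP[j0 sj0] : [exists j, s j != j].
  apply: contraNT s_neq1; rewrite negb_exists => /forallP s1.
  by apply/eqP/permP => j; rewrite perm1; apply/eqP/negPn/s1.
have [j sj min_j] :=
  @arg_minnP _ j0 (fun j => s j != j) (fun j : 'I_m.+1 => val j) sj0.
have fix_lt (j' : 'I_m.+1) : (j' < j)%N -> s j' = j'.
  by move=> lt_j'; apply/eqP; apply: contraTT lt_j' => /min_j; rewrite -leqNgt.
have lt_j_sj : (j < s j)%N.
  rewrite ltn_neqAle eq_sym val_eqE sj leqNgt; apply/negP => /fix_lt /perm_inj e.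
  by rewrite e eqxx in sj.
apply/word_ltP; exists (d (w j)) => [l lt_l|]; last first.
  by rewrite target_rewire D_decr.
rewrite -(permKV d l) in lt_l *; set i := (d^-1)%g l in lt_l *.
case: (widen_ord_cases lt_mn i) lt_l => [[j' ->]|le_i] lt_l; last first.
  by rewrite target_perm !permM permK (extend_perm_out _ _ le_i).
rewrite target_rewire fix_lt // ltnNge; apply/negP.
rewrite leq_eqVlt => /orP[/eqP/val_inj ejj'|/d_incr]; last first.
  by rewrite ltnNge ltnW.
by rewrite ejj' ltnn in lt_l.
Qed.

Lemma erased_rewire_lt s j :
  (word (rook_p (d (w j)) * rewire s)%g < word D)%O.
Proof.
have lt_s : (word (rook_p (d (w j)) * rewire s)%g < word (rewire s))%O.
  by apply: word_p_lt; rewrite -target_eq0 target_rewire -lt0n target_pos.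
have [s1|/rewire_lt lt_sD] := eqVneq s 1%g; first by move: lt_s; rewrite s1 rewire1.
exact: Order.POrderTheory.lt_trans lt_s lt_sD.
Qed.

(** Conjugation by d moves Y to the tops of the chosen edges of D. *)
Lemma rewire_expansion :
  diag F (rook_perm d^-1%g) * Y * diag F (rook_perm d * D)%g
  = \sum_(s : 'S_m.+1) (-1) ^+ s *: (diag F (rewire s)
      - \sum_j diag F (rook_p (d (w j)) * rewire s)%g).
Proof.
rewrite /Y widened_antisymmetrizerE mulr_sumr mulr_suml; apply: eq_bigr => s _.
rewrite -scalerAr -scalerAl mulrBr mulrBl; congr (_ *: (_ - _)).
  by rewrite !diagMr /rewire !rook_permM !mulgA.
rewrite mulr_sumr mulr_suml; apply: eq_bigr => j _; rewrite !diagMr; congr diag.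
apply: target_inj => l; rewrite /rewire -!mulgA !(target_perm, target_p) !permM.
by rewrite (canF_eq (permKV d)).
Qed.

End Rewiring.

Variable I : rook_alg F n -> Prop.
Hypothesis I_ideal : two_sided_ideal I.
Hypothesis I_Y : I Y.

Lemma idealZ k a : I a -> I (k *: a).
Proof.
have [_ _ IM] := I_ideal => Ia.
by have := IM k%:A a 1 Ia; rewrite mulr1 -scalerAl mul1r.
Qed.

Definition straightens a : Prop :=
  exists2 b, I (a - b) & forall D, b D != 0 -> layered m D.

Lemma straightens_ideal a : I a -> straightens a.
Proof.
by exists 0 => [|D]; rewrite ?subr0 // ffunE eqxx.
Qed.

Lemma straightens_lin k a b :
  straightens a -> straightens b -> straightens (k *: a + b).
Proof.
have [_ ID _] := I_ideal => -[a' Ia a'_lay] [b' Ib b'_lay].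
exists (k *: a' + b') => [|D].
  by rewrite opprD addrACA -scalerBr; apply: ID => //; apply: idealZ.
rewrite !ffunE; have [a'D|/a'_lay //] := eqVneq (a' D) 0.
by rewrite a'D scaler0 add0r; apply: b'_lay.
Qed.

Lemma straightens_sum (J : Type) (r : seq J) (P : pred J) (k : J -> F) a :
  (forall j, P j -> straightens (a j)) ->
  straightens (\sum_(j <- r | P j) k j *: a j).
Proof.
have [I0 _ _] := I_ideal => aP; elim/big_rec: _ => [|j b Pj].
  exact: straightens_ideal.
by apply: straightens_lin; apply: aP.
Qed.

(** In the expansion of the multiple of Y, the identity contributes D and all
    other terms are smaller than D, so they straighten by induction. *)
Lemma straightens_diag D : straightens (diag F D).
Proof.
elim/word_ind: D => D IH; case: (layered_or_decreasing m D) => [D_lay|[A [cardA A_noniso decA]]].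
  have [I0 _ _] := I_ideal.
  exists (diag F D) => [|E]; first by rewrite subrr.
  by rewrite ffunE; case: (eqVneq E D) => [-> //|_]; rewrite eqxx.
have [d /block_increasingP d_incr d_im] := block_increasing_ex A.
rewrite cardA in d_incr d_im.
have dA j : d (w j) \in A by rewrite -d_im; apply: imset_f; rewrite inE /=.
have incr (j j' : 'I_m.+1) : (j < j')%N -> (d (w j) < d (w j'))%N.
  by move=> lt_j; apply: d_incr => //=; rewrite ltn_ord.
have pos j : (0 < target D (d (w j)))%N.
  by rewrite lt0n target_eq0 -in_setC (subsetP A_noniso).
have decr (j j' : 'I_m.+1) : (j < j')%N -> (target D (d (w j')) < target D (d (w j)))%N.
  by move=> lt_j; apply: decA; rewrite ?dA ?incr.
have [_ _ IM] := I_ideal.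
have := IM (diag F (rook_perm d^-1%g)) _ (diag F (rook_perm d * D)%g) I_Y.
rewrite rewire_expansion (bigD1 1%g) //= odd_perm1 expr0 scale1r rewire1.
set P := \sum_(j < m.+1) diag F _.
set X := \sum_(s | _) _ => I_Z.
have -> : diag F D = (-1) *: X + (1 *: P + (diag F D - P + X)).
  by rewrite scaleN1r scale1r [P + _]addrA [P + _]addrC subrK addrC addKr.
apply: straightens_lin.
  apply: straightens_sum => s s_neq1; rewrite -scaleN1r addrC.
  apply: straightens_lin; last exact: IH (rewire_lt _ _ _).
  under eq_bigr => j _ do rewrite -[diag _ _]scale1r.
  by apply: straightens_sum => j _; apply: IH; apply: erased_rewire_lt.
apply: straightens_lin; last exact: straightens_ideal.
under [P]eq_bigr => j _ do rewrite -[diag _ _]scale1r.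
apply: straightens_sum => j _; apply: IH; rewrite -{1}(rewire1 D d).
exact: erased_rewire_lt.
Qed.

Lemma straightening a : straightens a.
Proof.
elim/rook_alg_ind: a => [k a b|D]; first exact: straightens_lin.
exact: straightens_diag.
Qed.

End Straightening.


(** * The annihilator *)

(** The coordinate of (x, y) along v0 is x / v0, as v0 is any nonzero scalar. *)
Lemma sum_basis_coordinates (F : fieldType) (V : vectType F) m (v0 : F^o)
    (v : m.-tuple V) :
  basis_of {:F^o} [:: v0] -> basis_of {:V} v ->
  exists c : 'I_m.+1 -> (F^o * V)%type -> F,
    [/\ forall i (k : F) x y, c i (k *: x + y) = k * c i x + c i y,
        forall u, u = \sum_i c i u *: sum_basis v0 v i
      & forall i j, c i (sum_basis v0 v j) = (i == j)%:R].
Proof.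
move=> bv0 bv.
have v0_neq0 : v0 != 0 by have := basis_free bv0; rewrite seq1_free.
exists (fun i u => if unlift ord0 i is Some k then coord v k u.2
                   else (u.1 : F) / v0).
split=> [i k x y|[x u]|i j].
- case: (unlift _ _) => [l|]; first by rewrite linearP.
  by rewrite /= mulrDl mulrA.
- rewrite big_ord_recl /sum_basis unlift_none.
  under eq_bigr => i _ do rewrite liftK.
  apply: injective_projections.
    rewrite /= (raddf_sum fst) /= big1 ?addr0 => [|i _]; last exact: scaler0.
    by rewrite /GRing.scale /= divfK.
  rewrite /= (raddf_sum snd) /= scaler0 add0r.
  rewrite [LHS](coord_basis bv) ?memvf //; apply: eq_bigr => i _.
  by rewrite (tnth_nth 0).
- rewrite /sum_basis; case: unliftP => [k|] ->; case: unliftP => [l|] ->.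
  + rewrite /= (tnth_nth 0) coord_free ?(basis_free bv) //.
    by rewrite (inj_eq lift_inj) eq_sym.
  + by rewrite /= linear0.
  + by rewrite /= mul0r.
  + by rewrite /= divff.
Qed.

Lemma annihilator_ideal (F : fieldType) n (T : lmodType F)
    (act : rook_alg F n -> T -> T) :
  left_action act -> two_sided_ideal (annihilator act).
Proof.
move=> act_left; have act0 x : act 0 x = 0.
  have := left_actionDl act_left (-1) 1 1 x.
  by rewrite !scaleN1r !addNr.
have actr0 a : act a 0 = 0.
  have := left_actionDr act_left (-1) a 0 0.
  by rewrite scaler0 addr0 scaleN1r addNr.
split=> // [a b a0 b0 x|a b c b0 x].
  by rewrite -[a]scale1r (left_actionDl act_left) a0 b0 scaler0 addr0.
by rewrite !(left_actionM act_left) b0 actr0.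
Qed.

Lemma generated_ideal_ideal (A : pzRingType) (y : A) :
  two_sided_ideal (generated_ideal y).
Proof.
split=> [I [] //|a b Ia Ib I idI Iy|a b c Ib I idI Iy].
  by have [_ ID _] := idI; apply: ID; [apply: Ia | apply: Ib].
by have [_ _ IM] := idI; apply: IM; apply: Ib.
Qed.

Theorem theorem1p2 (m n : nat) (lt_mn : (m < n)%N)
    (F : fieldType) (charF0 : [pchar F] =i pred0)
    (V : vectType F) (dimV : \dim {:V} = m)
    (v0 : F^o) (v0_basis : basis_of {:F^o} [:: v0])
    (v : m.-tuple V) (v_basis : basis_of {:V} v)
    (T : lmodType F) (tens : {ffun 'I_n -> (F^o * V)%type} -> T)
    (T_tensor : tensor_power tens)
    (act : rook_alg F n -> T -> T)
    (act_rook : rook_action tens (sum_basis v0 v) act)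
    (a : rook_alg F n) :
  annihilator act a
    <-> generated_ideal (rook_alg_widen lt_mn (antisymmetrizer F m.+1)) a.
Proof.
have [c [c_lin c_sum c_e]] := sum_basis_coordinates v0_basis v_basis.
have act_left := rook_action_left act_rook.
set Y := rook_alg_widen _ _.
have gen_ann b : generated_ideal Y b -> annihilator act b.
  move=> Ib; apply: Ib (annihilator_ideal act_left) _.
  exact: (antisymmetrizer_annihilates c_sum T_tensor act_rook).
split=> [a_ann|]; last exact: gen_ann.
have [b Iab b_lay] : straightens m (generated_ideal Y) a.
  apply: (straightening (generated_ideal_ideal Y)) => I _ IY; exact: IY.
suff b0 : b = 0 by rewrite b0 subr0 in Iab.
apply: (layered_independent c_lin c_e T_tensor act_rook) => // x.
have := gen_ann _ Iab x.
have -> : a - b = (-1) *: b + a by rewrite scaleN1r addrC.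
by rewrite (left_actionDl act_left) a_ann addr0 scaleN1r => /eqP; rewrite oppr_eq0 => /eqP.
Qed.
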